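(* Let $\alpha>0$, $\mu\in\mathbb{R}$, $\sigma>0$, and let $X\sim GGD(\mu,\sigma,\alpha)$. Then for every real $t\neq 0$ the characteristic function of $X$ is $$\varphi_\alpha(t)=\mathbb{E}[e^{itX}]=\frac{\sqrt{\pi}}{\Gamma(1/\alpha)}\,e^{it\mu}\,{\rm H}^{1,1}_{1,2}\!\left[\frac{\sigma^2\Gamma(1/\alpha)}{4\Gamma(3/\alpha)}\,t^2\ \middle|\ \begin{matrix}(1-\tfrac1\alpha,\tfrac2\alpha)\\(0,1),(\tfrac12,1)\end{matrix}\right],$$ that is, $$\varphi_\alpha(t)=\frac{\sqrt{\pi}}{\Gamma(1/\alpha)}\,e^{it\mu}\,\frac{1}{2\pi i}\int_{L}\frac{\Gamma(s)\,\Gamma\!\left(\frac{1}{\alpha}-\frac{2s}{\alpha}\right)}{\Gamma\!\left(\frac12-s\right)}\left(\frac{\sigma^2\Gamma(1/\alpha)}{4\Gamma(3/\alpha)}t^2\right)^{-s}ds .$$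
   Context: For $\alpha>0$, $\mu\in\mathbb{R}$, $\sigma>0$, a random variable $X\sim GGD(\mu,\sigma,\alpha)$ (generalized Gaussian) has density $f_X(x)=\frac{\alpha\Lambda}{2\Gamma(1/\alpha)}\exp(-\Lambda^\alpha|x-\mu|^\alpha)$, $x\in\mathbb{R}$, where $\Lambda=\frac{1}{\sigma}\sqrt{\Gamma(3/\alpha)/\Gamma(1/\alpha)}$; it has mean $\mu$ and variance $\sigma^2$. The Fox H-function is defined by the Mellin–Barnes integral ${\rm H}^{m,n}_{p,q}\!\left[z\,\middle|\,\begin{matrix}(a_1,A_1),\dots,(a_p,A_p)\\(b_1,B_1),\dots,(b_q,B_q)\end{matrix}\right]=\frac{1}{2\pi i}\int_L\frac{\prod_{j=1}^m\Gamma(b_j+B_js)\prod_{i=1}^n\Gamma(1-a_i-A_is)}{\prod_{j=m+1}^q\Gamma(1-b_j-B_js)\prod_{i=n+1}^p\Gamma(a_i+A_is)}\,z^{-s}\,ds$ (with $A_i,B_j>0$), where $L$ is a suitable contour (as in Kilbas–Saigo, ''H-Transforms'') separating the poles of the $\Gamma(b_j+B_js)$, $j\le m$, from those of the $\Gamma(1-a_i-A_is)$, $i\le n$. *)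

(* Defs.v *)
From Stdlib Require Import Reals Lra ClassicalEpsilon.
Open Scope R_scope.

Definition Cplx := (R * R)%type.
Definition RtoC (x : R) : Cplx := (x, 0).
Definition Cadd (z w : Cplx) : Cplx := (fst z + fst w, snd z + snd w).
Definition Cmul (z w : Cplx) : Cplx :=
  (fst z * fst w - snd z * snd w, fst z * snd w + snd z * fst w).
Definition Cinv (z : Cplx) : Cplx :=
  let d := fst z ^ 2 + snd z ^ 2 in (fst z / d, - snd z / d).
Definition Cdiv (z w : Cplx) : Cplx := Cmul z (Cinv w).
Definition Cexpi (th : R) : Cplx := (cos th, sin th).

(* x^a for x >= 0 (with 0^a = 0, a > 0) *)
Definition rpow (x a : R) : R := if Rlt_dec 0 x then Rpower x a else 0.

Definition improper_int_pos (f : R -> R) (l : R) : Prop :=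
  forall eps, 0 < eps -> exists d M, 0 < d /\
    forall a b, 0 < a <= d -> M <= b ->
      exists pr : Riemann_integrable f a b, Rabs (RiemannInt pr - l) < eps.

Definition improper_int_R (f : R -> R) (l : R) : Prop :=
  forall eps, 0 < eps -> exists M,
    forall a b, a <= - M -> M <= b ->
      exists pr : Riemann_integrable f a b, Rabs (RiemannInt pr - l) < eps.

Definition improper_int_R_C (f : R -> Cplx) (l : Cplx) : Prop :=
  improper_int_R (fun x => fst (f x)) (fst l) /\
  improper_int_R (fun x => snd (f x)) (snd l).

Definition Gamma (x : R) : R :=
  epsilon (inhabits 0)
    (fun l => improper_int_pos (fun t => Rpower t (x - 1) * exp (- t)) l).

(* complex Gamma on the right half-plane Re z > 0 (only used there):
   Gamma(x+iy) = int_0^oo t^(x-1) e^(-t) e^(i y ln t) dt *)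
Definition CGamma (z : Cplx) : Cplx :=
  (epsilon (inhabits 0) (fun l => improper_int_pos
      (fun t => Rpower t (fst z - 1) * exp (- t) * cos (snd z * ln t)) l),
   epsilon (inhabits 0) (fun l => improper_int_pos
      (fun t => Rpower t (fst z - 1) * exp (- t) * sin (snd z * ln t)) l)).

Definition GGD_Lambda (sigma alpha : R) : R :=
  / sigma * sqrt (Gamma (3 / alpha) / Gamma (1 / alpha)).

Definition GGD_density (mu sigma alpha x : R) : R :=
  let L := GGD_Lambda sigma alpha in
  alpha * L / (2 * Gamma (1 / alpha)) *
  exp (- (rpow L alpha * rpow (Rabs (x - mu)) alpha)).

Definition GGD_charfun_is (mu sigma alpha t : R) (phi : Cplx) : Prop :=
  improper_int_R_C (fun x => Cmul (RtoC (GGD_density mu sigma alpha x)) (Cexpi (t * x))) phi.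

(* Mellin–Barnes integrand  Gamma(b1+B1 s) Gamma(1-a1-A1 s) / Gamma(1-b2-B2 s) * z^(-s),
   for real z > 0 and s = c + i y. *)
Definition FoxH_11_12_integrand (a1 A1 b1 B1 b2 B2 z c y : R) : Cplx :=
  let s : Cplx := (c, y) in
  let g1 := CGamma (b1 + B1 * fst s, B1 * snd s) in
  let g2 := CGamma (1 - a1 - A1 * fst s, - (A1 * snd s)) in
  let g3 := CGamma (1 - b2 - B2 * fst s, - (B2 * snd s)) in
  (* z^(-s) = z^(-c) e^{-i y ln z} *)
  let zs := Cmul (RtoC (Rpower z (- c))) (Cexpi (- (y * ln z))) in
  Cmul (Cdiv (Cmul g1 g2) g3) zs.

(* h = H^{1,1}_{1,2}[z | (a1,A1) ; (b1,B1),(b2,B2)] computed along the vertical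
   contour L = c + i R:  (1/(2 pi i)) int_L F(s) ds = (1/(2 pi)) int_R F(c+iy) dy *)
Definition FoxH_11_12_along (a1 A1 b1 B1 b2 B2 z c : R) (h : Cplx) : Prop :=
  improper_int_R_C
    (fun y => Cmul (RtoC (/ (2 * PI))) (FoxH_11_12_integrand a1 A1 b1 B1 b2 B2 z c y)) h.

(* Main.v *)
(** In the variable v = ln x every integral over (0, oo) becomes an integral over
    the line, and every integrand met below is continuous and O(1 / (1 + v^2)), so
    a Fubini theorem for functions of two variables dominated by
    K / ((1 + x^2) (1 + y^2)) suffices throughout.

    Put s = c + i y.  Fourier inversion of v |-> exp (a v - e^v), whose transform is
    y |-> Gamma(a + i y), represents x^alpha exp (- x^alpha) as an integral of
    Gamma(1 + (1 - 2 s) / alpha) x^(2 s - 1) over y.  One integration by parts turns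
    the cosine transform of exp (- x^alpha) into the sine transform of
    x^(alpha - 1) exp (- x^alpha), after which the exchange with the Mellin
    transform int sin(tau x) x^(2 s - 2) dx is absolutely convergent on the whole
    strip 0 < c < 1/2.  Representing Gamma(3/2 - s) x^(2 s - 3) as an integral of
    Gaussians and using the Fourier transform of the Gaussian,
    Gamma(3/2 - s) int sin(tau x) x^(2 s - 2) dx
      = (tau sqrt(pi) / 4) (tau^2 / 4)^(- s) Gamma(s),
    which is where the quotient Gamma(s) / Gamma(1/2 - s) comes from; no duplication
    or reflection formula is needed.  Decay of Gamma on vertical lines follows from
    its functional equation. *)

Require Import Defs.
From Stdlib Require Import Reals Lra ClassicalEpsilon.
From Coquelicot Require Import Coquelicot.
Open Scope R_scope.


(** * Integrals over the line of functions with quadratic decay *)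

(** Absolute convergence dictates the route. Pairing the cosine transform directly with Gamma((1 - 2
    s) / alpha) would lead to int cos(tau x) x^(2 s - 1) dx, which converges only conditionally for
    0 < c < 1/2. In the sine version the integrand is O(x^(2 c - 1)) at 0 and O(x^(2 c - 2)) at
    infinity, hence integrable exactly on that strip. The price is a shift by one in two Gamma
    factors: Gamma(1 + (1 - 2 s) / alpha) and Gamma(3/2 - s) each split off a multiple of 1/2 - s,
    and these multiples cancel against each other. What remains is a division by Gamma(1/2 - s), so
    Gamma must be shown to have no zero on the right half-plane; this comes from a moment estimate
    far to the right, carried back by the functional equation. The reciprocal 1 / Gamma(1/2 - s) is
    never estimated by itself: up to elementary factors the Mellin-Barnes integrand is a decaying
    Gamma factor times the Mellin transform of the sine, which is bounded on each vertical line of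
    the strip. *)

Definition quad_decay (f : R -> R) : Prop :=
  continuity f /\ exists K, forall x, Rabs (f x) <= K / (1 + x ^ 2).

(** A total function, so that integrals can be rewritten as terms without carrying existence proofs.
    For [quad_decay] functions the symmetric integer windows may be replaced by any windows
    exhausting the line, see [lim_RInt_to_Int]. *)
Definition Int (f : R -> R) : R :=
  real (Lim_seq (fun n => RInt f (- INR n) (INR n))).

Lemma ex_RInt_cont f a b : continuity f -> ex_RInt f a b.
Proof.
intros H; apply (ex_RInt_continuous (V := R_CompleteNormedModule)); intros z _.
now apply continuity_pt_filterlim.
Qed.
Local Hint Resolve ex_RInt_cont : core.

Lemma one_plus_sq_pos x : 0 < 1 + x ^ 2.
Proof. nra. Qed.

Lemma RInt_FTC F f a b : (forall x, is_derive F x (f x)) -> continuity f ->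
  RInt f a b = F b - F a.
Proof.
intros HF Hf; apply is_RInt_unique.
apply (is_RInt_derive (V := R_CompleteNormedModule)); intros x _; [apply HF|].
now apply continuity_pt_filterlim.
Qed.

Lemma continuity_inv_1px2 : continuity (fun x => / (1 + x ^ 2)).
Proof.
intros x; apply continuity_pt_inv; [reg|]. pose proof (one_plus_sq_pos x); lra.
Qed.

Lemma RInt_inv_1px2 a b : RInt (fun x => / (1 + x ^ 2)) a b = atan b - atan a.
Proof.
apply RInt_FTC; [|apply continuity_inv_1px2].
intros x; apply is_derive_Reals.
apply derivable_pt_lim_atan.
Qed.

Lemma RInt_scal_R (f : R -> R) k a b : continuity f ->
  RInt (fun x => k * f x) a b = k * RInt f a b.
Proof. intros H; exact (RInt_scal (V := R_CompleteNormedModule) f a b k (ex_RInt_cont f a b H)). Qed.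

Lemma RInt_plus_R f g a b : continuity f -> continuity g ->
  RInt (fun x => f x + g x) a b = RInt f a b + RInt g a b.
Proof. intros; apply (RInt_plus (V := R_CompleteNormedModule)); auto. Qed.

Lemma RInt_minus_R f g a b : continuity f -> continuity g ->
  RInt (fun x => f x - g x) a b = RInt f a b - RInt g a b.
Proof. intros; apply (RInt_minus (V := R_CompleteNormedModule)); auto. Qed.

Lemma RInt_Chasles_R f a b c : continuity f ->
  RInt f a b + RInt f b c = RInt f a c.
Proof. intros; apply (RInt_Chasles (V := R_CompleteNormedModule)); auto. Qed.

Lemma RInt_swap_R f a b : continuity f -> RInt f a b = - RInt f b a.
Proof. intros H; symmetry; exact (opp_RInt_swap f b a (ex_RInt_cont f b a H)). Qed.

(** The dominating function K / (1 + x^2) has the primitive K atan x; every tail estimate below is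
    an increment of atan. *)
Lemma RInt_quad_decay_le f K a b : continuity f ->
  (forall x, Rabs (f x) <= K / (1 + x ^ 2)) -> a <= b ->
  Rabs (RInt f a b) <= K * (atan b - atan a).
Proof.
intros Hf HK Hab.
rewrite <- RInt_inv_1px2, <- RInt_scal_R by apply continuity_inv_1px2.
eapply Rle_trans; [apply abs_RInt_le; auto|].
apply RInt_le; auto.
- apply ex_RInt_cont; intros x; apply (continuity_pt_comp f Rabs); [apply Hf|].
  apply Rcontinuity_abs.
- apply ex_RInt_cont; intros x; apply continuity_pt_mult; [reg|apply continuity_inv_1px2].
Qed.

Lemma atan_le x y : x <= y -> atan x <= atan y.
Proof. intros [H| ->]; [left; now apply atan_increasing|lra]. Qed.

Lemma quad_decay_K_nonneg f K : (forall x, Rabs (f x) <= K / (1 + x ^ 2)) -> 0 <= K.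
Proof.
intros H; specialize (H 0). pose proof (Rabs_pos (f 0)).
replace (K / (1 + 0 ^ 2)) with K in H by (field; lra). lra.
Qed.

Lemma RInt_diff_le f K a b a' b' : continuity f ->
  (forall x, Rabs (f x) <= K / (1 + x ^ 2)) -> a' <= a -> b <= b' ->
  Rabs (RInt f a' b' - RInt f a b) <= K * ((atan b' - atan b) + (atan a - atan a')).
Proof.
intros Hf HK Ha Hb.
rewrite <- (RInt_Chasles_R f a' a b'), <- (RInt_Chasles_R f a b b') by auto.
replace (_ + (_ + _) - _) with (RInt f b b' + RInt f a' a) by ring.
eapply Rle_trans; [apply Rabs_triang|].
pose proof (RInt_quad_decay_le f K b b' Hf HK Hb).
pose proof (RInt_quad_decay_le f K a' a Hf HK Ha). lra.
Qed.

Lemma atan_lim : is_lim_seq (fun n => atan (INR n)) (PI / 2).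
Proof.
apply is_lim_seq_spec; intros [eps He]; simpl.
assert (Hm : exists x, 0 < x /\ PI / 2 - eps < atan x).
{ pose proof PI_RGT_0.
  set (e := Rmin eps (PI / 4)).
  assert (0 < e <= eps /\ e <= PI / 4) as [[He0 He1] He2].
  { unfold e; repeat split; [apply Rmin_pos; lra|apply Rmin_l|apply Rmin_r]. }
  exists (tan (PI / 2 - e / 2)). split; [apply tan_gt_0; lra|].
  rewrite atan_tan; lra. }
destruct Hm as [x [Hx Hlt]].
destruct (INR_unbounded x) as [N HN]. exists N; intros n Hn.
pose proof (atan_bound (INR n)).
assert (atan x <= atan (INR n)) by (apply atan_le; apply le_INR in Hn; lra).
rewrite Rabs_left1; lra.
Qed.

(** Cauchy criterion: two windows differ by at most 2 K times the difference of the values of atan,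
    and atan n converges. *)
Lemma Int_lim f : quad_decay f -> is_lim_seq (fun n => RInt f (- INR n) (INR n)) (Int f).
Proof.
intros [Hf [K HK]]; unfold Int; apply Lim_seq_correct'.
apply ex_lim_seq_cauchy_corr.
assert (Hc : ex_lim_seq_cauchy (fun n => atan (INR n))).
{ apply ex_lim_seq_cauchy_corr; exists (PI / 2); apply atan_lim. }
pose proof (quad_decay_K_nonneg f K HK) as HK0.
intros [eps He]; simpl.
(* The summand 1 keeps the denominator positive when K = 0. *)
assert (He' : 0 < eps / (2 * K + 1)) by (apply Rdiv_lt_0_compat; lra).
destruct (Hc (mkposreal _ He')) as [N HN]; exists N; simpl in HN.
assert (Hw : forall n m, (N <= n)%nat -> (N <= m)%nat -> (n <= m)%nat ->
  Rabs (RInt f (- INR n) (INR n) - RInt f (- INR m) (INR m)) < eps).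
{ intros n m Hn Hm Hnm; apply le_INR in Hnm.
  rewrite Rabs_minus_sym.
  eapply Rle_lt_trans; [apply (RInt_diff_le f K); auto; lra|].
  rewrite !atan_opp.
  specialize (HN m n Hm Hn).
  pose proof (Rle_abs (atan (INR m) - atan (INR n))).
  assert (H2 : atan (INR m) - atan (INR n) < eps / (2 * K + 1)) by lra.
  apply Rle_lt_trans with (2 * K * (eps / (2 * K + 1))).
  - replace (K * _) with (2 * K * (atan (INR m) - atan (INR n))) by ring.
    apply Rmult_le_compat_l; lra.
  - apply Rlt_le_trans with ((2 * K + 1) * (eps / (2 * K + 1))); [|right; field; lra].
    apply Rmult_lt_compat_r; lra. }
intros n m Hn Hm. destruct (Nat.le_ge_cases n m); [now apply Hw|].
rewrite Rabs_minus_sym; now apply Hw.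
Qed.

Lemma Int_err f K a b : continuity f -> (forall x, Rabs (f x) <= K / (1 + x ^ 2)) ->
  Rabs (Int f - RInt f a b) <= K * ((PI / 2 - atan b) + (atan a + PI / 2)).
Proof.
intros Hf HK.
assert (Hl : is_lim_seq (fun n => Rabs (RInt f (- INR n) (INR n) - RInt f a b)) (Rabs (Int f - RInt f a b))).
{ apply (is_lim_seq_abs _ (Finite _)). apply is_lim_seq_minus'; [|apply is_lim_seq_const].
  apply Int_lim; split; eauto. }
assert (Hr : is_lim_seq (fun n => K * ((atan (INR n) - atan b) + (atan a + atan (INR n))))
   (K * ((PI / 2 - atan b) + (atan a + PI / 2)))).
{ apply (is_lim_seq_scal_l _ K (Finite _)).
  apply is_lim_seq_plus'.
  - apply is_lim_seq_minus'; [apply atan_lim|apply is_lim_seq_const].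
  - apply is_lim_seq_plus'; [apply is_lim_seq_const|apply atan_lim]. }
destruct (INR_unbounded (Rmax b (- a))) as [N HN].
refine (is_lim_seq_le_loc _ _ _ _ _ Hl Hr).
exists N; intros n Hn; apply le_INR in Hn.
pose proof (Rmax_l b (- a)); pose proof (Rmax_r b (- a)).
replace (atan a + atan (INR n)) with (atan a - atan (- INR n)) by (rewrite atan_opp; ring).
apply RInt_diff_le; auto; lra.
Qed.

Lemma Int_bound f K : continuity f -> (forall x, Rabs (f x) <= K / (1 + x ^ 2)) ->
  Rabs (Int f) <= K * PI.
Proof.
intros Hf HK. pose proof (Int_err f K 0 0 Hf HK) as H.
assert (RInt f 0 0 = 0) as E by apply (RInt_point (V := R_CompleteNormedModule)).
rewrite E, atan_0 in H. replace (Int f) with (Int f - 0) by ring.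
eapply Rle_trans; [exact H|]. right; field.
Qed.

Lemma Int_unique f l : is_lim_seq (fun n => RInt f (- INR n) (INR n)) l -> Int f = real l.
Proof. intros H; unfold Int; now rewrite (is_lim_seq_unique _ _ H). Qed.

Lemma Int_ext f g : (forall x, f x = g x) -> Int f = Int g.
Proof.
intros H; unfold Int; f_equal; apply Lim_seq_ext; intros n.
apply (RInt_ext (V := R_CompleteNormedModule)); auto.
Qed.

Lemma quad_decay_plus f g : quad_decay f -> quad_decay g -> quad_decay (fun x => f x + g x).
Proof.
intros [Hf [K HK]] [Hg [L HL]]; split; [now apply continuity_plus|].
exists (K + L); intros x. eapply Rle_trans; [apply Rabs_triang|].
specialize (HK x); specialize (HL x). unfold Rdiv in *; lra.
Qed.

Lemma quad_decay_scal k f : quad_decay f -> quad_decay (fun x => k * f x).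
Proof.
intros [Hf [K HK]]; split; [apply continuity_mult; [intros x; reg|auto]|].
exists (Rabs k * K); intros x. rewrite Rabs_mult.
unfold Rdiv; rewrite Rmult_assoc.
apply Rmult_le_compat_l; [apply Rabs_pos|apply HK].
Qed.

Lemma quad_decay_ext f g : (forall x, f x = g x) -> quad_decay f -> quad_decay g.
Proof.
intros H [Hf [K HK]]; split.
- intros x; apply continuity_pt_ext with f; auto. 
- exists K; intros x; rewrite <- H; auto.
Qed.

Lemma Int_plus f g : quad_decay f -> quad_decay g -> Int (fun x => f x + g x) = Int f + Int g.
Proof.
intros Hf Hg; apply (Int_unique _ (Finite _)).
eapply is_lim_seq_ext; [|apply is_lim_seq_plus'; [apply (Int_lim f Hf)|apply (Int_lim g Hg)]].
intros n; simpl; symmetry; apply RInt_plus_R; [apply Hf|apply Hg].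
Qed.

Lemma Int_scal k f : quad_decay f -> Int (fun x => k * f x) = k * Int f.
Proof.
intros Hf; apply (Int_unique _ (Finite _)).
eapply is_lim_seq_ext; [|exact (is_lim_seq_scal_l _ k (Finite _) (Int_lim f Hf))].
intros n; simpl; symmetry; apply RInt_scal_R, Hf.
Qed.

Lemma Int_minus f g : quad_decay f -> quad_decay g -> Int (fun x => f x - g x) = Int f - Int g.
Proof.
intros Hf Hg.
rewrite (Int_ext _ (fun x => f x + (-1) * g x)) by (intros; ring).
rewrite Int_plus, Int_scal by (auto using quad_decay_scal). ring.
Qed.

Lemma quad_decay_minus f g : quad_decay f -> quad_decay g -> quad_decay (fun x => f x - g x).
Proof.
intros Hf Hg; apply quad_decay_ext with (fun x => f x + (-1) * g x); [intros; ring|].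
auto using quad_decay_plus, quad_decay_scal.
Qed.

Lemma Int_le f g : quad_decay f -> quad_decay g -> (forall x, f x <= g x) -> Int f <= Int g.
Proof.
intros Hf Hg H. refine (is_lim_seq_le _ _ (Finite _) (Finite _) _ (Int_lim f Hf) (Int_lim g Hg)).
intros n; apply RInt_le; auto; try (apply ex_RInt_cont; first [apply Hf|apply Hg]).
pose proof (pos_INR n); lra.
Qed.

Lemma Int_pos f : quad_decay f -> (forall x, 0 < f x) -> 0 < Int f.
Proof.
intros Hf H.
assert (Hle : RInt f (-1) 1 <= Int f).
{ refine (is_lim_seq_le_loc (fun _ => RInt f (-1) 1) _ (Finite _) (Finite _) _
    (is_lim_seq_const _) (Int_lim f Hf)).
  exists 1%nat; intros n Hn; apply le_INR in Hn; simpl in Hn.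
  assert (Hc : continuity f) by apply Hf.
  rewrite <- (RInt_Chasles_R f (- INR n) (-1) (INR n)), <- (RInt_Chasles_R f (-1) 1 (INR n)) by auto.
  assert (forall a b, a <= b -> 0 <= RInt f a b).
  { intros a b Hab; apply RInt_ge_0; auto. intros x _; left; apply H. }
  pose proof (H0 (- INR n) (-1) ltac:(lra)); pose proof (H0 1 (INR n) ltac:(lra)); lra. }
eapply Rlt_le_trans; [|exact Hle].
apply RInt_gt_0; [lra|auto|]. intros x _; apply continuity_pt_filterlim, Hf.
Qed.

(** A change of variables does not preserve symmetric windows, so [Int] has to be recovered from
    arbitrary ones. *)
Lemma lim_RInt_to_Int f a b : quad_decay f ->
  is_lim_seq a m_infty -> is_lim_seq b p_infty ->
  is_lim_seq (fun n => RInt f (a n) (b n)) (Int f).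
Proof.
intros [Hf [K HK]] Ha Hb.
assert (Hla : is_lim_seq (fun n => atan (a n)) (- (PI / 2))).
{ apply is_lim_seq_spec; intros eps.
  assert (H := atan_lim). apply is_lim_seq_spec in H. destruct (H eps) as [N HN].
  apply is_lim_seq_spec in Ha. destruct (Ha (- INR N)) as [M HM].
  exists M; intros n Hn. specialize (HM n Hn). specialize (HN N (Nat.le_refl _)).
  pose proof (atan_bound (a n)). pose proof (atan_bound (INR N)).
  pose proof (atan_le (a n) (- INR N) ltac:(lra)). rewrite atan_opp in H2.
  rewrite Rabs_left in HN by lra. rewrite Rabs_right by lra. lra. }
assert (Hlb : is_lim_seq (fun n => atan (b n)) (PI / 2)).
{ apply is_lim_seq_spec; intros eps.
  assert (H := atan_lim). apply is_lim_seq_spec in H. destruct (H eps) as [N HN].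
  apply is_lim_seq_spec in Hb. destruct (Hb (INR N)) as [M HM].
  exists M; intros n Hn. specialize (HM n Hn). specialize (HN N (Nat.le_refl _)).
  pose proof (atan_bound (b n)). pose proof (atan_bound (INR N)).
  pose proof (atan_le (INR N) (b n) ltac:(lra)).
  rewrite Rabs_left in HN by lra. rewrite Rabs_left by lra. lra. }
apply is_lim_seq_ext with (fun n => Int f - (Int f - RInt f (a n) (b n))); [intros; ring|].
replace (Finite (Int f)) with (Finite (Int f - 0)) by (f_equal; ring).
apply is_lim_seq_minus'; [apply is_lim_seq_const|].
apply is_lim_seq_abs_0.
apply is_lim_seq_le_le with (fun _ => 0) (fun n => K * ((PI / 2 - atan (b n)) + (atan (a n) + PI / 2))).
- intros n; split; [apply Rabs_pos|now apply Int_err].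
- apply is_lim_seq_const.
- replace 0 with (K * ((PI / 2 - PI / 2) + (- (PI / 2) + PI / 2))) by ring.
  apply (is_lim_seq_scal_l _ K (Finite _)).
  apply is_lim_seq_plus'.
  + apply is_lim_seq_minus'; [apply is_lim_seq_const|auto].
  + apply is_lim_seq_plus'; [auto|apply is_lim_seq_const].
Qed.

Lemma div_1px2_le K L x y : 0 <= K -> 1 + x ^ 2 <= L * (1 + y ^ 2) ->
  K / (1 + y ^ 2) <= K * L / (1 + x ^ 2).
Proof.
intros HK H. pose proof (one_plus_sq_pos x); pose proof (one_plus_sq_pos y).
unfold Rdiv; rewrite Rmult_assoc; apply Rmult_le_compat_l; auto.
apply Rmult_le_reg_r with (1 + x ^ 2); auto. rewrite Rmult_assoc, Rinv_l, Rmult_1_r by lra.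
apply Rmult_le_reg_l with (1 + y ^ 2); auto.
rewrite <- Rmult_assoc, Rinv_r by lra. lra.
Qed.

Lemma quad_decay_affine f k m : k <> 0 -> quad_decay f -> quad_decay (fun x => f (k * x + m)).
Proof.
intros Hk [Hf [K HK]]; split.
- apply (continuity_comp (fun x => k * x + m) f); auto. intros x; reg.
(* The constant comes from x^2 <= 2 ((k x + m)^2 + m^2) / k^2. *)
- exists (K * (1 + 2 * m ^ 2 / k ^ 2 + 2 / k ^ 2)); intros x.
  eapply Rle_trans; [apply HK|]. apply div_1px2_le; [now apply quad_decay_K_nonneg with f|].
  assert (0 < k ^ 2) by (apply pow2_gt_0; auto).
  assert (x ^ 2 <= 2 * ((k * x + m) ^ 2 + m ^ 2) / k ^ 2).
  { apply Rmult_le_reg_r with (k ^ 2); auto. unfold Rdiv at 1; rewrite Rmult_assoc, Rinv_l by lra.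
    pose proof (pow2_ge_0 (k * x + 2 * m)). nra. }
  pose proof (pow2_ge_0 (k * x + m)); set (u := (k * x + m) ^ 2) in *.
  assert (0 <= m ^ 2 / k ^ 2) by (apply Rdiv_le_0_compat; auto; nra).
  assert (0 < / k ^ 2) by (now apply Rinv_0_lt_compat).
  unfold Rdiv in *. nra.
Qed.

Lemma RInt_affine f k m a b : continuity f ->
  k * RInt (fun x => f (k * x + m)) a b = RInt f (k * a + m) (k * b + m).
Proof.
intros Hf. rewrite <- (RInt_comp_lin (V := R_CompleteNormedModule) f k m a b) by auto.
symmetry; apply RInt_scal_R.
apply (continuity_comp (fun x => k * x + m) f); auto. intros x; reg.
Qed.

Lemma is_lim_seq_INR_affine k m : 0 < k -> is_lim_seq (fun n => k * INR n + m) p_infty.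
Proof.
intros Hk. apply is_lim_seq_spec; intros M.
destruct (INR_unbounded ((M - m) / k)) as [N HN]; exists N; intros n Hn; apply le_INR in Hn.
apply Rlt_le_trans with (k * INR N + m).
- apply Rmult_lt_compat_l with (r := k) in HN; auto.
  replace (k * ((M - m) / k)) with (M - m) in HN by (field; lra). lra.
- pose proof (Rmult_le_compat_l k _ _ (Rlt_le _ _ Hk) Hn); lra.
Qed.

Lemma is_lim_seq_INR_affine_m k m : 0 < k -> is_lim_seq (fun n => k * (- INR n) + m) m_infty.
Proof.
intros Hk. apply is_lim_seq_ext with (fun n => - (k * INR n + - m)); [intros; ring|].
apply (is_lim_seq_opp _ p_infty). now apply is_lim_seq_INR_affine.
Qed.

Lemma Int_affine_pos f k m : 0 < k -> quad_decay f -> k * Int (fun x => f (k * x + m)) = Int f.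
Proof.
intros Hk Hf.
rewrite <- Int_scal by (apply quad_decay_affine; auto; lra).
apply (Int_unique _ (Finite _)).
eapply is_lim_seq_ext;
 [|apply (lim_RInt_to_Int f (fun n => k * (- INR n) + m) (fun n => k * INR n + m) Hf)].
- intros n; simpl. rewrite <- RInt_affine by apply Hf. rewrite RInt_scal_R; auto.
  apply quad_decay_affine; auto; lra.
- now apply is_lim_seq_INR_affine_m.
- now apply is_lim_seq_INR_affine.
Qed.

Lemma Int_opp_arg f : quad_decay f -> Int (fun x => f (- x)) = Int f.
Proof.
intros Hf. apply (Int_unique _ (Finite _)).
eapply is_lim_seq_ext; [|apply (Int_lim f Hf)].
intros n; simpl. assert (Hc : continuity f) by apply Hf.
pose proof (RInt_affine f (-1) 0 (- INR n) (INR n) Hc) as H.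
replace (-1 * - INR n + 0) with (INR n) in H by ring.
replace (-1 * INR n + 0) with (- INR n) in H by ring.
rewrite (RInt_swap_R f (INR n)) in H by auto.
rewrite (RInt_ext (V := R_CompleteNormedModule) _ (fun x => f (- x))) in H;
 [lra|intros x _; f_equal; ring].
Qed.

Lemma Int_affine f k m : k <> 0 -> quad_decay f -> Rabs k * Int (fun x => f (k * x + m)) = Int f.
Proof.
intros Hk Hf. destruct (Rdichotomy _ _ Hk) as [H|H].
- rewrite Rabs_left by auto.
  rewrite <- (Int_affine_pos f (- k) m) by (auto; lra). f_equal.
  rewrite <- (Int_opp_arg (fun x => f (k * x + m))) by (apply quad_decay_affine; auto).
  apply Int_ext; intros x; f_equal; ring.
- rewrite Rabs_right by lra. now apply Int_affine_pos.
Qed.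

Lemma Int_odd f : quad_decay f -> (forall x, f (- x) = - f x) -> Int f = 0.
Proof.
intros Hf H. pose proof (Int_opp_arg f Hf) as E.
rewrite (Int_ext _ (fun x => (-1) * f x)) in E by (intros; rewrite H; ring).
rewrite Int_scal in E by auto. lra.
Qed.

Lemma Int_derive F f lp lm : (forall x, is_derive F x (f x)) -> continuity f ->
  is_lim_seq (fun n => F (INR n)) (Finite lp) ->
  is_lim_seq (fun n => F (- INR n)) (Finite lm) -> Int f = lp - lm.
Proof.
intros HF Hf H1 H2. apply (Int_unique _ (Finite _)).
eapply is_lim_seq_ext; [|apply (is_lim_seq_minus' _ _ _ _ H1 H2)].
intros n; symmetry; now apply RInt_FTC.
Qed.

Lemma is_lim_seq_INR : is_lim_seq INR p_infty.
Proof.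
eapply is_lim_seq_ext; [|apply (is_lim_seq_INR_affine 1 0); lra]. intros; simpl; ring.
Qed.

Lemma quad_decay_lim0 F : quad_decay F ->
  is_lim_seq (fun n => F (INR n)) (Finite 0) /\ is_lim_seq (fun n => F (- INR n)) (Finite 0).
Proof.
intros [_ [K HK]].
assert (Hl : is_lim_seq (fun n => K / (1 + INR n ^ 2)) 0).
{ replace (Finite 0) with (Rbar_mult (Finite K) (Finite 0)) by (simpl; f_equal; ring).
  apply (is_lim_seq_scal_l _ K (Finite 0)).
  apply (is_lim_seq_inv _ p_infty); [|discriminate].
  apply is_lim_seq_le_p_loc with INR; [|apply is_lim_seq_INR].
  exists 0%nat; intros n _. pose proof (pos_INR n); nra. }
split; apply is_lim_seq_abs_0;
apply is_lim_seq_le_le with (fun _ => 0) (fun n => K / (1 + INR n ^ 2));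
 auto using is_lim_seq_const; intros n; split; try apply Rabs_pos.
- apply HK.
- replace (INR n ^ 2) with ((- INR n) ^ 2) by ring. apply HK.
Qed.

Lemma Int_derive0 F f : (forall x, is_derive F x (f x)) -> continuity f -> quad_decay F -> Int f = 0.
Proof.
intros H Hf HF. destruct (quad_decay_lim0 F HF) as [H1 H2].
rewrite (Int_derive F f 0 0); auto; ring.
Qed.

(** * The substitution x = e^v *)

Lemma continuity_exp : continuity exp.
Proof. intros x; apply derivable_continuous_pt, derivable_pt_exp. Qed.

Lemma RInt_exp_subst f a b : continuity f ->
  RInt (fun v => exp v * f (exp v)) a b = RInt f (exp a) (exp b).
Proof.
intros Hf. apply (RInt_comp (V := R_CompleteNormedModule) f exp exp).
- intros x _; apply continuity_pt_filterlim, Hf.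
- intros x _; split; [apply is_derive_Reals, derivable_pt_lim_exp|].
  apply continuity_pt_filterlim, continuity_exp.
Qed.

Lemma is_lim_seq_exp_INR : is_lim_seq (fun n => exp (INR n)) p_infty.
Proof.
apply is_lim_seq_le_p_loc with INR; [|apply is_lim_seq_INR].
exists 0%nat; intros n _; left. pose proof (exp_ineq1_le (INR n)); lra.
Qed.

(** The windows [-n, n] in v are the windows [e^(-n), e^n] in x; the missing piece [0, e^(-n)]
    contributes at most K e^(-n), and evenness accounts for the factor 1/2. *)
Lemma Int_even_log f : quad_decay f -> (forall x, f (- x) = f x) ->
  Int (fun v => exp v * f (exp v)) = / 2 * Int f.
Proof.
intros Hf He. assert (Hc : continuity f) by apply Hf.
apply (Int_unique _ (Finite _)).
assert (Hev : forall b, RInt f (- b) b = 2 * RInt f 0 b).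
{ intros b. rewrite <- (RInt_Chasles_R f (- b) 0 b) by auto.
  assert (RInt f (- b) 0 = RInt f 0 b); [|lra].
  rewrite (RInt_swap_R f) by auto.
  pose proof (RInt_affine f (-1) 0 0 b Hc) as H.
  replace (-1 * 0 + 0) with 0 in H by ring. replace (-1 * b + 0) with (- b) in H by ring.
  rewrite <- H.
  rewrite (RInt_ext (V := R_CompleteNormedModule) _ f); [lra|].
  intros x _; rewrite <- He; f_equal; ring. }
apply is_lim_seq_ext with
 (fun n => / 2 * RInt f (- exp (INR n)) (exp (INR n)) - RInt f 0 (exp (- INR n))).
{ intros n. rewrite RInt_exp_subst, Hev by auto.
  rewrite <- (RInt_Chasles_R f (exp (- INR n)) 0) by auto.
  rewrite (RInt_swap_R f (exp (- INR n)) 0) by auto. field. }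
replace (/ 2 * Int f) with (/ 2 * Int f - 0) by ring.
apply is_lim_seq_minus'.
- apply (is_lim_seq_scal_l _ (/ 2) (Finite _)).
  apply (lim_RInt_to_Int f (fun n => - exp (INR n)) (fun n => exp (INR n))); auto.
  + apply (is_lim_seq_opp _ p_infty), is_lim_seq_exp_INR.
  + apply is_lim_seq_exp_INR.
- destruct Hf as [_ [K HK]]. pose proof (quad_decay_K_nonneg f K HK).
  apply is_lim_seq_abs_0.
  apply is_lim_seq_le_le with (fun _ => 0) (fun n => K * / exp (INR n)).
  + intros n; split; [apply Rabs_pos|].
    rewrite <- exp_Ropp. replace (K * exp (- INR n)) with ((exp (- INR n) - 0) * K) by ring.
    pose proof (exp_pos (- INR n)).
    apply abs_RInt_le_const; auto; [lra|]. intros t _.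
    eapply Rle_trans; [apply HK|]. unfold Rdiv. rewrite <- (Rmult_1_r K) at 2.
    apply Rmult_le_compat_l; auto. rewrite <- Rinv_1. apply Rinv_le_contravar; nra.
  + apply is_lim_seq_const.
  + replace (Finite 0) with (Rbar_mult (Finite K) (Finite 0)) by (simpl; f_equal; ring).
    apply (is_lim_seq_scal_l _ K (Finite 0)).
    apply (is_lim_seq_inv _ p_infty); [apply is_lim_seq_exp_INR|discriminate].
Qed.

(** * Integrals depending on a parameter and Fubini's theorem *)

Definition cont2 (f : R -> R -> R) := forall x y, continuity_2d_pt f x y.

Lemma cont2_swap f : cont2 f -> cont2 (fun x y => f y x).
Proof.
intros H x y eps. destruct (H y x eps) as [d Hd]. exists d; intros u v Hu Hv; now apply Hd.
Qed.

Lemma cont2_l f y : cont2 f -> continuity (fun x => f x y).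
Proof.
intros H x. apply continuity_pt_filterlim.
apply (filterlim_locally (F := locally x) (fun x => f x y) (f x y)).
intros eps. destruct (H x y eps) as [d Hd].
exists d; intros u Hu. apply Hd; [exact Hu|]. rewrite Rminus_diag, Rabs_R0; apply cond_pos.
Qed.

Lemma cont2_r f x : cont2 f -> continuity (fun y => f x y).
Proof. intros H. exact (cont2_l _ x (cont2_swap f H)). Qed.

Lemma RInt_param_cont f a b : cont2 f -> a <= b -> continuity (fun y => RInt (fun x => f x y) a b).
Proof.
intros H Hab y. apply continuity_pt_filterlim.
apply (filterlim_locally (F := locally y) (fun y => RInt (fun x => f x y) a b)).
intros [eps He].
assert (He' : 0 < eps / (b - a + 1)) by (apply Rdiv_lt_0_compat; lra).
destruct (uniform_continuity_2d_1d f a b y (fun x _ => H x y) (mkposreal _ He')) as [d Hd].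
exists d; intros z Hz. change (Rabs (RInt (fun x => f x z) a b - RInt (fun x => f x y) a b) < eps).
change (Rabs (z - y) < d) in Hz. pose proof (cond_pos d). apply Rabs_def2 in Hz.
rewrite <- (RInt_minus_R (fun x => f x z) (fun x => f x y)) by now apply cont2_l.
apply Rle_lt_trans with ((b - a) * (eps / (b - a + 1))).
- apply abs_RInt_le_const; auto.
  + apply ex_RInt_cont, (continuity_minus (fun x => f x z) (fun x => f x y)); now apply cont2_l.
  + intros t Ht. left.
    simpl in Hd. apply Hd; try lra. rewrite Rminus_diag, Rabs_R0; lra.
- apply Rlt_le_trans with ((b - a + 1) * (eps / (b - a + 1))); [|right; field; lra].
  apply Rmult_lt_compat_r; lra.
Qed.

(** The domination allows truncation to one window [-N, N] at a cost of eps / 4 uniformly in y; on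
    that window continuity is the compact case [RInt_param_cont]. *)
Lemma Int_param_cont f K : cont2 f -> (forall x y, Rabs (f x y) <= K / (1 + x ^ 2)) ->
  continuity (fun y => Int (fun x => f x y)).
Proof.
intros H HK y. apply continuity_pt_filterlim.
apply (filterlim_locally (F := locally y) (fun y => Int (fun x => f x y))).
intros [eps He].
assert (HKK : 0 <= K) by (apply quad_decay_K_nonneg with (fun x => f x 0); auto).
assert (He' : 0 < eps / (8 * K + 8)) by (apply Rdiv_lt_0_compat; lra).
destruct (proj2 (is_lim_seq_spec _ _) atan_lim (mkposreal _ He')) as [N HN]; simpl in HN.
specialize (HN N (Nat.le_refl _)).
pose proof (atan_bound (INR N)).
assert (Hs : forall z, Rabs (Int (fun x => f x z) - RInt (fun x => f x z) (- INR N) (INR N)) <= eps / 4).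
{ intros z. eapply Rle_trans; [apply (Int_err _ K); [now apply cont2_l|auto]|].
  rewrite atan_opp. rewrite Rabs_left in HN by lra.
  apply Rle_trans with (K * (2 * (eps / (8 * K + 8)))).
  - apply Rmult_le_compat_l; auto; lra.
  - apply Rle_trans with ((K + 1) * (2 * (eps / (8 * K + 8)))); [|right; field; lra].
    apply Rmult_le_compat_r; lra. }
pose proof (RInt_param_cont f (- INR N) (INR N) H ltac:(pose proof (pos_INR N); lra) y) as Hc.
apply continuity_pt_filterlim in Hc.
destruct (proj1 (filterlim_locally (F := locally y) _ _) Hc (mkposreal (eps / 2) ltac:(lra))) as [d Hd].
exists d; intros z Hz. specialize (Hd z Hz).
change (Rabs (RInt (fun x => f x z) (- INR N) (INR N) - RInt (fun x => f x y) (- INR N) (INR N)) < eps / 2) in Hd.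
change (Rabs (Int (fun x => f x z) - Int (fun x => f x y)) < eps).
pose proof (Hs y) as Hy. pose proof (Hs z) as Hz'.
apply Rabs_def2 in Hd. apply Rabs_le_between in Hy, Hz'. apply Rabs_def1; lra.
Qed.

(** As functions of the upper limit b the two sides have the same derivative, by differentiation
    under the integral sign, and both vanish at b = a. *)
Lemma RInt_Fubini f a b c d : cont2 f -> a <= b -> c <= d ->
  RInt (fun x => RInt (fun y => f x y) c d) a b = RInt (fun y => RInt (fun x => f x y) a b) c d.
Proof.
intros H Hab Hcd.
assert (H1 : forall y, continuity (fun x => f x y)) by (intros; now apply cont2_l).
assert (H2 : forall x, continuity (fun y => f x y)) by (intros; now apply cont2_r).
assert (HG : continuity (fun x => RInt (fun y => f x y) c d)).
{ apply (RInt_param_cont (fun y x => f x y)); auto. now apply cont2_swap. }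
assert (D1 : forall u y, is_derive (fun z => RInt (fun x => f x y) a z) u (f u y)).
{ intros u y. apply (is_derive_RInt (V := R_CompleteNormedModule) (fun x => f x y) _ a).
  - apply filter_forall; intros z. apply RInt_correct; auto.
  - apply continuity_pt_filterlim, H1. }
assert (Hy : forall z, continuity (fun y => RInt (fun x => f x y) a z)).
{ intros z. destruct (Rle_dec a z); [now apply RInt_param_cont|].
  intros y; apply continuity_pt_ext with (fun y => - RInt (fun x => f x y) z a).
  - intros t; symmetry; now apply RInt_swap_R.
  - apply continuity_pt_opp, RInt_param_cont; auto; lra. }
assert (D2 : forall u, is_derive (fun z => RInt (fun y => RInt (fun x => f x y) a z) c d) u
   (RInt (fun y => f u y) c d)).
{ intros u.
  pose proof (is_derive_RInt_param (fun z y => RInt (fun x => f x y) a z) c d u) as P.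
  rewrite (RInt_ext (V := R_CompleteNormedModule) _ (fun y => f u y)) in P.
  2:{ intros y _; now apply is_derive_unique. }
  apply P.
  - apply filter_forall; intros z t _; eexists; apply D1.
  - intros t _. apply continuity_2d_pt_ext with f; [|apply H].
    intros x y; symmetry; now apply is_derive_unique.
  - apply filter_forall; intros z. auto. }
etransitivity; [exact (RInt_FTC _ _ a b D2 HG)|].
assert (Z : RInt (fun y => RInt (fun x => f x y) a a) c d = 0).
{ rewrite (RInt_ext (V := R_CompleteNormedModule) _ (fun _ => 0)).
  - rewrite (RInt_const (V := R_CompleteNormedModule)). apply Rmult_0_r.
  - intros; apply (RInt_point (V := R_CompleteNormedModule)). }
match goal with |- ?A - ?B = _ => change (A - B) with (A - RInt (fun y => RInt (fun x => f x y) a a) c d) end.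
rewrite Z, Rminus_0_r; reflexivity.
Qed.

(** Cutting the inner integral at n costs at most K (PI - 2 atan n) / (1 + x^2), whose integral over
    x tends to 0. The iterated integral is therefore the limit of integrals over the squares
    [-n, n]^2, where the order of integration is immaterial. *)
Lemma Fubini_aux f K : cont2 f ->
  (forall x y, Rabs (f x y) <= K / ((1 + x ^ 2) * (1 + y ^ 2))) ->
  quad_decay (fun x => Int (fun y => f x y)) /\
  is_lim_seq (fun n => RInt (fun x => RInt (fun y => f x y) (- INR n) (INR n)) (- INR n) (INR n))
     (Int (fun x => Int (fun y => f x y))).
Proof.
intros H HK.
assert (HKK : 0 <= K).
{ specialize (HK 0 0). pose proof (Rabs_pos (f 0 0)).
  replace (K / _) with K in HK by (field; lra). lra. }
assert (HKx : forall x y, Rabs (f x y) <= (K / (1 + x ^ 2)) / (1 + y ^ 2)).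
{ intros x y. eapply Rle_trans; [apply HK|]. right. field.
  pose proof (one_plus_sq_pos x); pose proof (one_plus_sq_pos y); lra. }
assert (Hpos : forall x, 0 <= K / (1 + x ^ 2)).
{ intros x. apply Rdiv_le_0_compat; auto. apply one_plus_sq_pos. }
assert (H2 : forall x, continuity (fun y => f x y)) by (intros; now apply cont2_r).
assert (HA : continuity (fun x => Int (fun y => f x y))).
{ apply (Int_param_cont (fun y x => f x y) K); [now apply cont2_swap|].
  intros y x. eapply Rle_trans; [apply HKx|].
  unfold Rdiv; apply Rmult_le_compat_r.
  - left; apply Rinv_0_lt_compat, one_plus_sq_pos.
  - rewrite <- (Rmult_1_r K) at 2. apply Rmult_le_compat_l; auto.
    rewrite <- Rinv_1. apply Rinv_le_contravar; nra. }
assert (HAK : forall x, Rabs (Int (fun y => f x y)) <= K * PI / (1 + x ^ 2)).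
{ intros x. eapply Rle_trans; [apply Int_bound; auto; apply HKx|]. right; field.
  pose proof (one_plus_sq_pos x); lra. }
assert (Hq : quad_decay (fun x => Int (fun y => f x y))) by (split; eauto).
split; auto.
apply is_lim_seq_ext with (fun n => RInt (fun x => Int (fun y => f x y)) (- INR n) (INR n) -
  RInt (fun x => Int (fun y => f x y) - RInt (fun y => f x y) (- INR n) (INR n)) (- INR n) (INR n)).
{ intros n. pose proof (pos_INR n).
  assert (continuity (fun x => RInt (fun y => f x y) (- INR n) (INR n))).
  { apply (RInt_param_cont (fun y x => f x y)); [now apply cont2_swap|lra]. }
  rewrite RInt_minus_R by auto; ring. }
replace (Finite (Int _)) with (Finite (Int (fun x => Int (fun y => f x y)) - 0)) by (f_equal; ring).
apply is_lim_seq_minus'; [now apply Int_lim|].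
apply is_lim_seq_abs_0.
apply is_lim_seq_le_le with (fun _ => 0) (fun n => (K * PI) * (2 * (PI / 2 - atan (INR n)))).
- intros n; split; [apply Rabs_pos|]. pose proof (pos_INR n).
  pose proof (atan_bound (INR n)) as Hb.
  eapply Rle_trans.
  + apply RInt_quad_decay_le with (K := K * (2 * (PI / 2 - atan (INR n)))); [| |lra].
    * apply (continuity_minus (fun x => Int (fun y => f x y))); auto.
      apply (RInt_param_cont (fun y x => f x y)); [now apply cont2_swap|lra].
    * intros x. pose proof (Int_err _ _ (- INR n) (INR n) (H2 x) (HKx x)) as E.
      eapply Rle_trans; [apply E|]. rewrite atan_opp. right; field.
      pose proof (one_plus_sq_pos x); lra.
  + rewrite atan_opp.
    replace (K * PI * _) with (K * (2 * (PI / 2 - atan (INR n))) * PI) by ring.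
    apply Rmult_le_compat_l; [|lra]. apply Rmult_le_pos; lra.
- apply is_lim_seq_const.
- replace 0 with (K * PI * (2 * (PI / 2 - PI / 2))) by ring.
  apply (is_lim_seq_scal_l _ _ (Finite _)). apply (is_lim_seq_scal_l _ _ (Finite _)).
  apply is_lim_seq_minus'; [apply is_lim_seq_const|apply atan_lim].
Qed.

Lemma Int_Fubini f K : cont2 f ->
  (forall x y, Rabs (f x y) <= K / ((1 + x ^ 2) * (1 + y ^ 2))) ->
  Int (fun x => Int (fun y => f x y)) = Int (fun y => Int (fun x => f x y)).
Proof.
intros H HK.
destruct (Fubini_aux f K H HK) as [_ L1].
destruct (Fubini_aux (fun y x => f x y) K) as [_ L2].
{ now apply cont2_swap. }
{ intros y x. rewrite (Rmult_comm (1 + y ^ 2)). apply HK. }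
eapply is_lim_seq_ext in L2.
- apply is_lim_seq_unique in L1. apply is_lim_seq_unique in L2. rewrite L1 in L2. now injection L2.
- intros n. simpl. pose proof (pos_INR n). apply RInt_Fubini; [now apply cont2_swap| |]; lra.
Qed.

(** * Complex-valued integrands *)

Ltac solve_cont := match goal with
  | |- continuity _ => let x := fresh in intros x; solve_cont
  | |- continuity_pt ?f ?x => apply continuity_pt_filterlim,
     (ex_derive_continuous (V := R_NormedModule) f x); auto_derive; auto
  end.
Ltac solve_cont2 :=
  let x := fresh in let y := fresh in intros x y;
  repeat first [ apply continuity_2d_pt_const | apply continuity_2d_pt_id1
   | apply continuity_2d_pt_id2 | apply continuity_2d_pt_mult | apply continuity_2d_pt_plus
   | apply continuity_2d_pt_minus | apply continuity_2d_pt_opp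
   | apply (continuity_1d_2d_pt_comp exp); [apply continuity_exp|]
   | apply (continuity_1d_2d_pt_comp cos); [apply continuity_cos|]
   | apply (continuity_1d_2d_pt_comp sin); [apply continuity_sin|] ].

Definition ccont (f : R -> C) := continuity (fun x => fst (f x)) /\ continuity (fun x => snd (f x)).
Definition ccont2 (f : R -> R -> C) := cont2 (fun x y => fst (f x y)) /\ cont2 (fun x y => snd (f x y)).
Definition cquad_decay (f : R -> C) := ccont f /\ exists K, forall x, Cmod (f x) <= K / (1 + x ^ 2).
Definition CInt (f : R -> C) : C := (Int (fun x => fst (f x)), Int (fun x => snd (f x))).

Lemma Re_le_Cmod z : Rabs (fst z) <= Cmod z.
Proof. eapply Rle_trans; [apply Rmax_l|apply Rmax_Cmod]. Qed.
Lemma Im_le_Cmod z : Rabs (snd z) <= Cmod z.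
Proof. eapply Rle_trans; [apply Rmax_r|apply Rmax_Cmod]. Qed.

Lemma Cmod_le_sum z : Cmod z <= Rabs (fst z) + Rabs (snd z).
Proof.
pose proof (Rabs_pos (fst z)); pose proof (Rabs_pos (snd z)).
unfold Cmod. rewrite <- (sqrt_pow2 (Rabs (fst z) + Rabs (snd z))) by lra.
apply sqrt_le_1_alt. rewrite <- (pow2_abs (fst z)), <- (pow2_abs (snd z)). nra.
Qed.

Lemma cquad_decay_re f : cquad_decay f -> quad_decay (fun x => fst (f x)).
Proof.
intros [[H1 H2] [K HK]]; split; auto. exists K; intros x.
eapply Rle_trans; [apply Re_le_Cmod|auto].
Qed.
Lemma cquad_decay_im f : cquad_decay f -> quad_decay (fun x => snd (f x)).
Proof.
intros [[H1 H2] [K HK]]; split; auto. exists K; intros x.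
eapply Rle_trans; [apply Im_le_Cmod|auto].
Qed.
Local Hint Resolve cquad_decay_re cquad_decay_im : core.

Lemma CInt_ext f g : (forall x, f x = g x) -> CInt f = CInt g.
Proof. intros H; unfold CInt; f_equal; apply Int_ext; intros x; now rewrite H. Qed.

Lemma ccont_ext f g : (forall x, f x = g x) -> ccont f -> ccont g.
Proof.
intros H [H1 H2]; split; intros x;
[apply continuity_pt_ext with (fun x => fst (f x))|apply continuity_pt_ext with (fun x => snd (f x))];
auto; intros; now rewrite H.
Qed.

Lemma cquad_decay_ext f g : (forall x, f x = g x) -> cquad_decay f -> cquad_decay g.
Proof.
intros H [H1 [K HK]]; split; [now apply ccont_ext with f|].
exists K; intros x; now rewrite <- H.
Qed.

Lemma ccont_const (c : C) : ccont (fun _ => c).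
Proof. split; intros x; apply continuity_pt_const; intros a b; reflexivity. Qed.

Lemma ccont_mult f g : ccont f -> ccont g -> ccont (fun x => Cmult (f x) (g x)).
Proof.
intros [F1 F2] [G1 G2]; split; simpl.
- apply (continuity_minus (fun x => fst (f x) * fst (g x)) (fun x => snd (f x) * snd (g x)));
  now apply continuity_mult.
- apply (continuity_plus (fun x => fst (f x) * snd (g x)) (fun x => snd (f x) * fst (g x)));
  now apply continuity_mult.
Qed.

Lemma ccont_plus f g : ccont f -> ccont g -> ccont (fun x => Cplus (f x) (g x)).
Proof. intros [F1 F2] [G1 G2]; split; simpl; now apply continuity_plus. Qed.

Lemma cquad_decay_scal k f : cquad_decay f -> cquad_decay (fun x => Cmult k (f x)).
Proof.
intros [H [K HK]]; split; [apply ccont_mult; auto using ccont_const|].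
exists (Cmod k * K); intros x; rewrite Cmod_mult. unfold Rdiv; rewrite Rmult_assoc.
apply Rmult_le_compat_l; [apply Cmod_ge_0|apply HK].
Qed.

Lemma cquad_decay_plus f g : cquad_decay f -> cquad_decay g -> cquad_decay (fun x => Cplus (f x) (g x)).
Proof.
intros [H [K HK]] [H' [L HL]]; split; [now apply ccont_plus|].
exists (K + L); intros x; eapply Rle_trans; [apply Cmod_triangle|].
specialize (HK x); specialize (HL x). unfold Rdiv in *; lra.
Qed.

Lemma CInt_scal k f : cquad_decay f -> CInt (fun x => Cmult k (f x)) = Cmult k (CInt f).
Proof.
intros Hf; unfold CInt, Cmult; simpl.
rewrite Int_minus, Int_plus, !Int_scal; auto using quad_decay_scal.
Qed.

Lemma CInt_minus f g : cquad_decay f -> cquad_decay g ->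
  CInt (fun x => Cminus (f x) (g x)) = Cminus (CInt f) (CInt g).
Proof. intros Hf Hg; unfold CInt, Cminus, Cplus, Copp; simpl. f_equal.
- exact (Int_minus (fun x => fst (f x)) (fun x => fst (g x)) (cquad_decay_re f Hf) (cquad_decay_re g Hg)).
- exact (Int_minus (fun x => snd (f x)) (fun x => snd (g x)) (cquad_decay_im f Hf) (cquad_decay_im g Hg)).
Qed.

Lemma cquad_decay_minus f g : cquad_decay f -> cquad_decay g -> cquad_decay (fun x => Cminus (f x) (g x)).
Proof.
intros Hf Hg. apply cquad_decay_ext with (fun x => Cplus (f x) (Cmult (RtoC (-1)) (g x))).
- intros x; apply injective_projections; simpl; ring.
- apply cquad_decay_plus; auto; now apply cquad_decay_scal.
Qed.

Lemma cquad_decay_affine f k m : k <> 0 -> cquad_decay f -> cquad_decay (fun x => f (k * x + m)).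
Proof.
intros Hk [[H1 H2] [K HK]]; split; [split|].
- apply (continuity_comp (fun x => k * x + m) (fun x => fst (f x))); auto; intros x; reg.
- apply (continuity_comp (fun x => k * x + m) (fun x => snd (f x))); auto; intros x; reg.
- destruct (quad_decay_affine (fun x => K / (1 + x ^ 2)) k m Hk) as [_ [L HL]].
  { split; [apply continuity_mult; [intros x; reg|apply continuity_inv_1px2]|].
    exists (Rabs K); intros x. unfold Rdiv; rewrite Rabs_mult.
    apply Req_le; f_equal. apply Rabs_right, Rle_ge; left.
    apply Rinv_0_lt_compat, one_plus_sq_pos. }
  exists L; intros x. eapply Rle_trans; [apply HK|]. eapply Rle_trans; [apply Rle_abs|apply HL].
Qed.

Lemma CInt_affine f k m : k <> 0 -> cquad_decay f ->
  Cmult (RtoC (Rabs k)) (CInt (fun x => f (k * x + m))) = CInt f.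
Proof.
intros Hk Hf. unfold CInt, RtoC, Cmult; simpl.
rewrite <- (Int_affine (fun x => fst (f x)) k m), <- (Int_affine (fun x => snd (f x)) k m) by auto.
f_equal; ring.
Qed.

Lemma CInt_bound f K : ccont f -> (forall x, Cmod (f x) <= K / (1 + x ^ 2)) ->
  Cmod (CInt f) <= 2 * PI * K.
Proof.
intros [H1 H2] HK. eapply Rle_trans; [apply Cmod_le_sum|]. unfold CInt; simpl.
assert (Rabs (Int (fun x => fst (f x))) <= K * PI).
{ apply Int_bound; auto. intros x; eapply Rle_trans; [apply Re_le_Cmod|auto]. }
assert (Rabs (Int (fun x => snd (f x))) <= K * PI).
{ apply Int_bound; auto. intros x; eapply Rle_trans; [apply Im_le_Cmod|auto]. }
lra.
Qed.

Lemma CInt_derive0 F f : (forall x, is_derive (fun x => fst (F x)) x (fst (f x))) ->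
  (forall x, is_derive (fun x => snd (F x)) x (snd (f x))) -> ccont f -> cquad_decay F ->
  CInt f = RtoC 0.
Proof.
intros H1 H2 [C1 C2] HF. unfold CInt, RtoC. f_equal.
- apply Int_derive0 with (fun x => fst (F x)); auto.
- apply Int_derive0 with (fun x => snd (F x)); auto.
Qed.

Lemma CInt_param_cont f K : ccont2 f -> (forall x y, Cmod (f x y) <= K / (1 + x ^ 2)) ->
  ccont (fun y => CInt (fun x => f x y)).
Proof.
intros [H1 H2] HK; split; simpl.
- apply (Int_param_cont (fun x y => fst (f x y)) K); auto.
  intros x y; eapply Rle_trans; [apply Re_le_Cmod|auto].
- apply (Int_param_cont (fun x y => snd (f x y)) K); auto.
  intros x y; eapply Rle_trans; [apply Im_le_Cmod|auto].
Qed.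

Lemma CInt_Fubini f K : ccont2 f ->
  (forall x y, Cmod (f x y) <= K / ((1 + x ^ 2) * (1 + y ^ 2))) ->
  CInt (fun x => CInt (fun y => f x y)) = CInt (fun y => CInt (fun x => f x y)).
Proof.
intros [H1 H2] HK; unfold CInt; simpl; f_equal.
- apply (Int_Fubini (fun x y => fst (f x y)) K); auto.
  intros x y; eapply Rle_trans; [apply Re_le_Cmod|auto].
- apply (Int_Fubini (fun x y => snd (f x y)) K); auto.
  intros x y; eapply Rle_trans; [apply Im_le_Cmod|auto].
Qed.

Lemma ccont2_mult f g : ccont2 f -> ccont2 g -> ccont2 (fun x y => Cmult (f x y) (g x y)).
Proof.
intros [F1 F2] [G1 G2]; split; intros x y; simpl.
- apply continuity_2d_pt_minus; apply continuity_2d_pt_mult; auto.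
- apply continuity_2d_pt_plus; apply continuity_2d_pt_mult; auto.
Qed.

Lemma cont2_of_l f : continuity f -> cont2 (fun x _ => f x).
Proof.
intros H x y. apply (continuity_1d_2d_pt_comp f (fun x _ => x)); [apply H|apply continuity_2d_pt_id1].
Qed.
Lemma cont2_of_r f : continuity f -> cont2 (fun _ y => f y).
Proof.
intros H x y. apply (continuity_1d_2d_pt_comp f (fun _ y => y)); [apply H|apply continuity_2d_pt_id2].
Qed.
Lemma ccont2_of_l f : ccont f -> ccont2 (fun x _ => f x).
Proof. intros [H1 H2]; split; [apply (cont2_of_l _ H1)|apply (cont2_of_l _ H2)]. Qed.
Lemma ccont2_of_r f : ccont f -> ccont2 (fun _ y => f y).
Proof. intros [H1 H2]; split; [apply (cont2_of_r _ H1)|apply (cont2_of_r _ H2)]. Qed.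

(** * The exponential of a + i b and bounds for exp (a v - e^v) *)

Definition cexp (a b : R) : C := (exp a * cos b, exp a * sin b).

Lemma cexp_mult a b a' b' : Cmult (cexp a b) (cexp a' b') = cexp (a + a') (b + b').
Proof.
unfold cexp, Cmult; simpl. rewrite exp_plus, cos_plus, sin_plus. f_equal; ring.
Qed.

Lemma Cmod_cexp a b : Cmod (cexp a b) = exp a.
Proof.
unfold cexp, Cmod; simpl fst; simpl snd.
replace (_ + _) with (exp a ^ 2 * ((sin b)² + (cos b)²)) by (unfold Rsqr; ring).
rewrite sin2_cos2, Rmult_1_r. apply sqrt_pow2; left; apply exp_pos.
Qed.

Lemma RtoC_exp a : RtoC (exp a) = cexp a 0.
Proof. unfold RtoC, cexp; rewrite cos_0, sin_0; f_equal; ring. Qed.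

Lemma exp_le x y : x <= y -> exp x <= exp y.
Proof. intros [H| ->]; [left; now apply exp_increasing|lra]. Qed.

Lemma exp_ge_quad v : 0 <= v -> 1 + v ^ 2 / 2 <= exp v.
Proof.
intros Hv.
destruct (MVT_gen (fun x => exp x - x ^ 2 / 2) 0 v (fun x => exp x - x)) as [c [Hc E]].
- intros x _. auto_derive; auto. field.
- intros x _. reg.
- rewrite exp_0 in E. pose proof (exp_ineq1_le c). simpl in E.
  assert (0 <= (exp c - c) * (v - 0)) by (apply Rmult_le_pos; lra). nra.
Qed.

Lemma exp_abs_bound eta x : 0 < eta ->
  exp (- eta * Rabs x) <= (1 + 2 / eta ^ 2) / (1 + x ^ 2).
Proof.
intros He. pose proof (one_plus_sq_pos x). pose proof (exp_pos (eta * Rabs x)).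
apply Rmult_le_reg_r with (1 + x ^ 2); auto.
replace ((1 + 2 / eta ^ 2) / (1 + x ^ 2) * (1 + x ^ 2)) with (1 + 2 / eta ^ 2) by (field; lra).
replace (- eta * Rabs x) with (- (eta * Rabs x)) by ring. rewrite exp_Ropp.
apply Rmult_le_reg_l with (exp (eta * Rabs x)); auto.
rewrite <- Rmult_assoc, Rinv_r, Rmult_1_l by lra.
assert (Hr : 1 + (eta * Rabs x) ^ 2 / 2 <= exp (eta * Rabs x)).
{ assert (0 <= eta * Rabs x) by (apply Rmult_le_pos; [lra|apply Rabs_pos]).
  now apply exp_ge_quad. }
apply Rle_trans with ((1 + (eta * Rabs x) ^ 2 / 2) * (1 + 2 / eta ^ 2)).
- rewrite Rpow_mult_distr, pow2_abs. assert (0 < eta ^ 2) by nra.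
  assert (0 < / eta ^ 2) by now apply Rinv_0_lt_compat.
  replace ((1 + eta ^ 2 * x ^ 2 / 2) * (1 + 2 / eta ^ 2)) with
    (1 + x ^ 2 + 2 * / eta ^ 2 + eta ^ 2 * x ^ 2 / 2) by (field; lra). nra.
- apply Rmult_le_compat_r; auto. assert (0 < 2 / eta ^ 2) by (apply Rdiv_lt_0_compat; nra). lra.
Qed.

(** For v >= 0, e^v >= 1 + v^2 / 2 and p v - v^2 / 2 <= p^2 / 2; for v <= 0 the left side is not
    positive. Every bound on a double exponential below is this one, with p chosen so that the
    remaining linear term decays on the side at hand. *)
Lemma sub_exp_le p v : 0 <= p -> p * v - exp v <= p ^ 2 / 2.
Proof.
intros Hp. pose proof (exp_pos v).
destruct (Rle_dec v 0) as [Hv|Hv].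
- nra.
- pose proof (exp_ge_quad v ltac:(lra)).
  pose proof (pow2_ge_0 (p - v)). nra.
Qed.

(** On the left e^v is dropped; on the right [sub_exp_le] with p = 2 a turns a v - e^v into 2 a^2 -
    a v. *)
Lemma gexp_bound a v : 0 < a -> exp (a * v - exp v) <= exp (2 * a ^ 2) * exp (- a * Rabs v).
Proof.
intros Ha. rewrite <- exp_plus. apply exp_le. unfold Rabs; destruct (Rcase_abs v).
- pose proof (exp_pos v). nra.
- pose proof (sub_exp_le (2 * a) v ltac:(lra)). nra.
Qed.

Lemma gexp_qbound a : 0 < a -> exists K, forall v, exp (a * v - exp v) <= K / (1 + v ^ 2).
Proof.
intros Ha. exists (exp (2 * a ^ 2) * (1 + 2 / a ^ 2)); intros v.
eapply Rle_trans; [now apply gexp_bound|].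
unfold Rdiv at 1; rewrite Rmult_assoc.
apply Rmult_le_compat_l; [left; apply exp_pos|now apply exp_abs_bound].
Qed.

(** * The Gaussian *)

Lemma quad_decay_exp_bound f C eta : 0 < eta -> continuity f ->
  (forall x, Rabs (f x) <= C * exp (- eta * Rabs x)) -> quad_decay f.
Proof.
intros He Hf H; split; auto. exists (C * (1 + 2 / eta ^ 2)); intros x.
eapply Rle_trans; [apply H|]. unfold Rdiv at 1; rewrite Rmult_assoc.
apply Rmult_le_compat_l; [|now apply exp_abs_bound].
specialize (H 0). pose proof (Rabs_pos (f 0)).
rewrite Rabs_R0, Rmult_0_r, exp_0 in H. lra.
Qed.

Lemma prod_exp_bound e1 e2 : 0 < e1 -> 0 < e2 -> exists K, 0 <= K /\ forall x y,
  exp (- e1 * Rabs x) * exp (- e2 * Rabs y) <= K / ((1 + x ^ 2) * (1 + y ^ 2)).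
Proof.
intros H1 H2. exists ((1 + 2 / e1 ^ 2) * (1 + 2 / e2 ^ 2)).
assert (forall e, 0 < e -> 0 < 1 + 2 / e ^ 2).
{ intros e He; assert (0 < 2 / e ^ 2) by (apply Rdiv_lt_0_compat; nra); lra. }
split; [apply Rmult_le_pos; left; auto|].
intros x y. pose proof (one_plus_sq_pos x); pose proof (one_plus_sq_pos y).
replace (_ / _) with (((1 + 2 / e1 ^ 2) / (1 + x ^ 2)) * ((1 + 2 / e2 ^ 2) / (1 + y ^ 2)))
 by (field; repeat split; lra).
apply Rmult_le_compat; try (left; apply exp_pos); now apply exp_abs_bound.
Qed.

Lemma gauss_bound x : exp (- x ^ 2 / 2) <= 16 / (1 + x ^ 2) ^ 2.
Proof.
pose proof (one_plus_sq_pos x). assert (0 < (1 + x ^ 2) ^ 2) by (apply pow_lt; auto).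
apply Rmult_le_reg_r with ((1 + x ^ 2) ^ 2); auto.
replace (16 / (1 + x ^ 2) ^ 2 * (1 + x ^ 2) ^ 2) with 16 by (field; lra).
replace (- x ^ 2 / 2) with (- (x ^ 2 / 4 + x ^ 2 / 4)) by field.
rewrite exp_Ropp, exp_plus.
pose proof (exp_ineq1_le (x ^ 2 / 4)) as He. pose proof (exp_pos (x ^ 2 / 4)).
set (E := exp (x ^ 2 / 4)) in *.
apply Rmult_le_reg_l with (E * E); [nra|].
rewrite <- Rmult_assoc, Rinv_r by nra. nra.
Qed.

Lemma gauss_quad_decay (p : R -> R) : continuity p -> (forall x, Rabs (p x) <= 1 + x ^ 2) ->
  quad_decay (fun x => p x * exp (- x ^ 2 / 2)).
Proof.
intros Hc Hp; split.
- apply continuity_mult; auto. solve_cont.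
- exists 16; intros x. rewrite Rabs_mult, (Rabs_right (exp _)) by (left; apply exp_pos).
  pose proof (one_plus_sq_pos x).
  apply Rle_trans with ((1 + x ^ 2) * (16 / (1 + x ^ 2) ^ 2)).
  + apply Rmult_le_compat; try apply Rabs_pos; auto; [left; apply exp_pos|apply gauss_bound].
  + right; field; lra.
Qed.

Lemma quad_decay_gauss : quad_decay (fun x => exp (- x ^ 2 / 2)).
Proof.
apply quad_decay_ext with (fun x => 1 * exp (- x ^ 2 / 2)); [intros; ring|].
apply (gauss_quad_decay (fun _ => 1)); [solve_cont|]. intros x; rewrite Rabs_right; nra.
Qed.

(** Applying [sub_exp_le] with slopes k1 and k2 to the two double exponentials leaves (2 - k1 - k2)
    v + (1 - k2) p plus the constant (k1^2 + k2^2) / 4. In each quadrant the slopes make the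
    coefficients 1/4 and 1/2 up to a sign opposite to that of the variable. *)
Lemma gauss_log_bound v p : exp (2 * v + p - exp (2 * v) / 2 - exp (2 * v + 2 * p) / 2) <=
  exp 2 * (exp (- (/ 4) * Rabs v) * exp (- (/ 2) * Rabs p)).
Proof.
rewrite <- !exp_plus. apply exp_le.
pose proof (fun k H => sub_exp_le k (2 * v) H) as H1.
pose proof (fun k H => sub_exp_le k (2 * v + 2 * p) H) as H2.
unfold Rabs; destruct (Rcase_abs v), (Rcase_abs p).
- pose proof (H1 (5/4) ltac:(lra)); pose proof (H2 (1/2) ltac:(lra)); nra.
- pose proof (H1 (1/4) ltac:(lra)); pose proof (H2 (3/2) ltac:(lra)); nra.
- pose proof (H1 (7/4) ltac:(lra)); pose proof (H2 (1/2) ltac:(lra)); nra.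
- pose proof (H1 (3/4) ltac:(lra)); pose proof (H2 (3/2) ltac:(lra)); nra.
Qed.

Lemma is_lim_seq_exp_opp_INR : is_lim_seq (fun n => exp (- INR n)) 0.
Proof.
apply is_lim_seq_ext with (fun n => / exp (INR n)); [intros; now rewrite exp_Ropp|].
apply (is_lim_seq_inv _ p_infty); [apply is_lim_seq_exp_INR|discriminate].
Qed.

(** The two Gaussians combine to exp (- a e^(2 v)) with 2 a = 1 + e^(2 p), and the factor e^(2 v)
    makes the integrand an exact derivative. *)
Lemma Int_log_gauss_inner p :
  Int (fun v => exp (2 * v + p - exp (2 * v) / 2 - exp (2 * v + 2 * p) / 2)) =
  exp p / (1 + exp p ^ 2).
Proof.
pose proof (exp_pos p) as Hp. set (a := (1 + exp p ^ 2) / 2).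
assert (Ha : 0 < a) by (unfold a; nra).
assert (E : forall v, exp (2 * v) / 2 + exp (2 * v + 2 * p) / 2 = a * exp v ^ 2).
{ intros v; unfold a. replace (2 * v + 2 * p) with ((v + v) + (p + p)) by ring.
  replace (2 * v) with (v + v) by ring. rewrite !exp_plus. field. }
replace (exp p / (1 + exp p ^ 2)) with (0 - (- (exp p / (2 * a)))) by (unfold a; field; nra).
apply Int_derive with (fun v => - (exp p / (2 * a)) * exp (- (a * exp v ^ 2))).
- intros v.
  replace (exp (2 * v + p - exp (2 * v) / 2 - exp (2 * v + 2 * p) / 2))
    with (exp p * exp v ^ 2 * exp (- (a * exp v ^ 2))).
  + clearbody a. auto_derive; auto. simpl. field; lra.
  + replace (exp v ^ 2) with (exp (2 * v)) at 1
      by (replace (2 * v) with (v + v) by ring; rewrite exp_plus; ring).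
    rewrite <- E, <- !exp_plus. f_equal; ring.
- solve_cont.
- replace 0 with (- (exp p / (2 * a)) * 0) by ring.
  apply (is_lim_seq_scal_l _ _ (Finite 0)).
  apply is_lim_seq_le_le_loc with (fun _ => 0) (fun n => / a * exp (- INR n)).
  + exists 0%nat; intros n _; split; [left; apply exp_pos|].
    pose proof (exp_pos (INR n)); pose proof (pos_INR n).
    assert (1 <= exp (INR n)) by (pose proof (exp_ineq1_le (INR n)); lra).
    rewrite !exp_Ropp, <- Rinv_mult. apply Rinv_le_contravar; [nra|].
    pose proof (exp_ineq1_le (a * exp (INR n) ^ 2)).
    assert (a * exp (INR n) <= a * exp (INR n) ^ 2) by (apply Rmult_le_compat_l; nra). lra.
  + apply is_lim_seq_const.
  + replace 0 with (/ a * 0) by ring.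
    apply (is_lim_seq_scal_l _ _ (Finite 0)), is_lim_seq_exp_opp_INR.
- replace (Finite (- (exp p / (2 * a)))) with
    (Rbar_mult (- (exp p / (2 * a))) (exp (- (a * 0 ^ 2)))).
  2:{ replace (- (a * 0 ^ 2)) with 0 by ring. rewrite exp_0; simpl; f_equal; ring. }
  apply is_lim_seq_scal_l.
  apply (is_lim_seq_continuous (fun z => exp (- (a * z ^ 2))) _ 0); [solve_cont|].
  apply is_lim_seq_exp_opp_INR.
Qed.

Lemma Int_sech : Int (fun p => exp p / (1 + exp p ^ 2)) = PI / 2.
Proof.
replace (PI / 2) with (PI / 2 - atan 0) at 1 by (rewrite atan_0; ring).
apply Int_derive with (fun p => atan (exp p)).
- intros p. pose proof (exp_pos p).
  apply is_derive_ext with (fun p => atan (exp p)); auto.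
  replace (exp p / (1 + exp p ^ 2)) with (scal (exp p) (/ (1 + exp p ^ 2)))
    by (unfold scal; simpl; unfold mult; simpl; field; nra).
  apply (is_derive_comp atan exp).
  + apply is_derive_Reals, derivable_pt_lim_atan.
  + apply is_derive_Reals, derivable_pt_lim_exp.
- solve_cont. pose proof (exp_pos H). nra.
- apply is_lim_seq_spec; intros eps.
  destruct (proj2 (is_lim_seq_spec _ _) atan_lim eps) as [N HN].
  exists N; intros n Hn. specialize (HN n Hn).
  pose proof (exp_ineq1_le (INR n)).
  pose proof (atan_le (INR n) (exp (INR n)) ltac:(lra)).
  pose proof (atan_bound (INR n)); pose proof (atan_bound (exp (INR n))).
  rewrite Rabs_left in HN |- * by lra. lra.
- apply (is_lim_seq_continuous atan _ 0); [|apply is_lim_seq_exp_opp_INR].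
  apply derivable_continuous_pt, derivable_pt_atan.
Qed.

(** The classical double integral in the coordinates x = e^v, y = e^(v + p): the logarithm p of the
    ratio y / x replaces the polar angle. On the open quadrant it equals (G / 2)^2, and integrating
    over v first leaves the integral of 1 / (2 cosh p), which is PI / 2. *)
Lemma Int_gauss : Int (fun x => exp (- x ^ 2 / 2)) = sqrt (2 * PI).
Proof.
set (g := fun x => exp (- x ^ 2 / 2)). set (G := Int g).
set (h := fun v => exp v * g (exp v)).
assert (Hhe : forall v, h v = exp (v - exp (2 * v) / 2)).
{ intros v; unfold h, g. rewrite <- exp_plus; f_equal.
  replace (2 * v) with (v + v) by ring. rewrite exp_plus. field. }
assert (Hh : quad_decay h).
{ apply quad_decay_exp_bound with (exp 2) (/ 2); [lra|unfold h, g; solve_cont|].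
  intros v. rewrite Hhe, Rabs_right by (left; apply exp_pos).
  rewrite <- exp_plus; apply exp_le.
  unfold Rabs; destruct (Rcase_abs v);
   [pose proof (sub_exp_le (1/2) (2 * v) ltac:(lra))|pose proof (sub_exp_le (3/2) (2 * v) ltac:(lra))]; nra. }
assert (HG : Int h = G / 2).
{ unfold h, G. rewrite (Int_even_log g); [field|apply quad_decay_gauss|].
  intros x; unfold g; f_equal; field. }
assert (HG0 : 0 < G) by (apply Int_pos; [apply quad_decay_gauss|intros; apply exp_pos]).
set (f := fun v p => exp (2 * v + p - exp (2 * v) / 2 - exp (2 * v + 2 * p) / 2)).
assert (Hf : forall v p, f v p = h v * h (p + v)).
{ intros v p; unfold f. rewrite !Hhe, <- exp_plus. f_equal.
  replace (2 * (p + v)) with (2 * v + 2 * p) by ring. field. }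
assert (H1 : Int (fun v => Int (fun p => f v p)) = G / 2 * (G / 2)).
{ rewrite <- HG at 1. rewrite Rmult_comm, <- (Int_scal _ h) by auto. apply Int_ext; intros v.
  rewrite (Int_ext _ (fun p => h v * h (1 * p + v))) by (intros p; rewrite Hf; f_equal; f_equal; ring).
  rewrite Int_scal by (apply quad_decay_affine; auto; lra).
  rewrite Rmult_comm; f_equal. rewrite <- HG, <- (Int_affine_pos h 1 v) by (auto; lra). ring. }
destruct (prod_exp_bound (/ 4) (/ 2)) as [K [HK0 HK]]; [lra|lra|].
rewrite (Int_Fubini f (exp 2 * K)) in H1.
- rewrite (Int_ext _ (fun p => exp p / (1 + exp p ^ 2))) in H1 by (intros; apply Int_log_gauss_inner).
  rewrite Int_sech in H1.
  rewrite <- (sqrt_pow2 G) by lra. f_equal. lra.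
- unfold f. solve_cont2.
- intros v p. unfold f. rewrite Rabs_right by (left; apply exp_pos).
  eapply Rle_trans; [apply gauss_log_bound|].
  unfold Rdiv; rewrite Rmult_assoc. apply Rmult_le_compat_l; [left; apply exp_pos|apply HK].
Qed.

Lemma sin_lip x y : Rabs (sin x - sin y) <= Rabs (x - y).
Proof.
destruct (MVT_gen sin y x cos) as [c [_ E]].
- intros z _. apply is_derive_Reals, derivable_pt_lim_sin.
- intros z _. apply continuity_sin.
- rewrite E, Rabs_mult. pose proof (COS_bound c). pose proof (Rabs_pos (x - y)).
  assert (Rabs (cos c) <= 1) by (apply Rabs_le; lra). nra.
Qed.

Lemma cos_taylor a d : Rabs (cos (a + d) - cos a + d * sin a) <= d ^ 2.
Proof.
destruct (MVT_gen cos a (a + d) (fun x => - sin x)) as [c [Hc E]].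
- intros z _. apply is_derive_Reals, derivable_pt_lim_cos.
- intros z _. apply continuity_cos.
- rewrite E. replace (_ + _) with (- d * (sin c - sin a)) by ring.
  rewrite Rabs_mult, Rabs_Ropp, <- (pow2_abs d). simpl; rewrite Rmult_1_r.
  apply Rmult_le_compat_l; [apply Rabs_pos|]. eapply Rle_trans; [apply sin_lip|].
  unfold Rmin, Rmax in Hc. unfold Rabs; destruct (Rle_dec a (a + d)), (Rcase_abs (c - a)), (Rcase_abs d); lra.
Qed.

Lemma quad_decay_bounded_mult f g M : quad_decay f -> continuity g -> (forall x, Rabs (g x) <= M) ->
  quad_decay (fun x => f x * g x).
Proof.
intros [Hf [K HK]] Hg HM; split; [now apply continuity_mult|].
exists (K * M); intros x. rewrite Rabs_mult.
replace (K * M / (1 + x ^ 2)) with ((K / (1 + x ^ 2)) * M) by (unfold Rdiv; ring).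
apply Rmult_le_compat; auto using Rabs_pos.
Qed.

Lemma Rabs_cos_le x : Rabs (cos x) <= 1.
Proof. pose proof (COS_bound x); apply Rabs_le; lra. Qed.
Lemma Rabs_sin_le x : Rabs (sin x) <= 1.
Proof. pose proof (SIN_bound x); apply Rabs_le; lra. Qed.

Lemma quad_decay_gauss_cos t : quad_decay (fun x => exp (- x ^ 2 / 2) * cos (t * x)).
Proof.
apply quad_decay_bounded_mult with 1; [apply quad_decay_gauss|solve_cont|intros; apply Rabs_cos_le].
Qed.

Lemma quad_decay_xgauss_sin t : quad_decay (fun x => x * exp (- x ^ 2 / 2) * sin (t * x)).
Proof.
apply quad_decay_bounded_mult with 1; [|solve_cont|intros; apply Rabs_sin_le].
apply (gauss_quad_decay (fun x => x)); [solve_cont|]. intros x; apply Rabs_le; nra.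
Qed.

(** Integration by parts. It provides the differential equation of the Gaussian cosine transform,
    and later the Gaussian integral behind the Mellin transform of the sine. *)
Lemma Int_xgauss_sin t : Int (fun x => x * exp (- x ^ 2 / 2) * sin (t * x)) =
  t * Int (fun x => exp (- x ^ 2 / 2) * cos (t * x)).
Proof.
rewrite <- Int_scal by apply quad_decay_gauss_cos.
apply Rminus_diag_uniq_sym. rewrite <- Int_minus;
 [|apply quad_decay_scal, quad_decay_gauss_cos|apply quad_decay_xgauss_sin].
apply Int_derive0 with (fun x => exp (- x ^ 2 / 2) * sin (t * x)).
- intros x. auto_derive; auto. unfold Rdiv; simpl; field.
- solve_cont.
- apply quad_decay_bounded_mult with 1; [apply quad_decay_gauss|solve_cont|intros; apply Rabs_sin_le].
Qed.

(** The Taylor error of cos ((t + h) x) is at most h^2 x^2, and [gauss_bound] turns it into 16 h^2 /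
    (1 + x^2), so the error of the difference quotient is at most 16 PI |h|. *)
Lemma is_derive_gauss_cos t : is_derive (fun t => Int (fun x => exp (- x ^ 2 / 2) * cos (t * x))) t
  (- (t * Int (fun x => exp (- x ^ 2 / 2) * cos (t * x)))).
Proof.
rewrite <- Int_xgauss_sin.
assert (Hd : forall h, Rabs (Int (fun x => exp (- x ^ 2 / 2) * cos ((t + h) * x)) -
   Int (fun x => exp (- x ^ 2 / 2) * cos (t * x)) +
   h * Int (fun x => x * exp (- x ^ 2 / 2) * sin (t * x))) <= h ^ 2 * 16 * PI).
{ intros h. rewrite <- Int_minus, <- Int_scal, <- Int_plus;
   auto using quad_decay_scal, quad_decay_minus, quad_decay_gauss_cos, quad_decay_xgauss_sin.
  apply Int_bound.
  - solve_cont.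
  - intros x. pose proof (one_plus_sq_pos x).
    replace (_ + _) with (exp (- x ^ 2 / 2) * (cos (t * x + h * x) - cos (t * x) + (h * x) * sin (t * x)))
      by (replace ((t + h) * x) with (t * x + h * x) by ring; ring).
    rewrite Rabs_mult, (Rabs_right (exp _)) by (left; apply exp_pos).
    apply Rle_trans with (16 / (1 + x ^ 2) ^ 2 * (h ^ 2 * (1 + x ^ 2))).
    + apply Rmult_le_compat; [left; apply exp_pos|apply Rabs_pos|apply gauss_bound|].
      eapply Rle_trans; [apply cos_taylor|]. rewrite Rpow_mult_distr.
      apply Rmult_le_compat_l; [apply pow2_ge_0|lra].
    + right; field; lra. }
apply is_derive_Reals. intros eps He. pose proof PI_RGT_0.
assert (Hd0 : 0 < eps / (16 * PI + 1)) by (apply Rdiv_lt_0_compat; lra).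
exists (mkposreal _ Hd0). intros h Hh0 Hh; simpl in Hh. specialize (Hd h). cbv beta in Hd |- *.
assert (0 < Rabs h) by now apply Rabs_pos_lt.
match type of Hd with Rabs (?A - ?B + h * ?D) <= _ =>
 replace ((A - B) / h - - D) with ((A - B + h * D) / h) by (field; auto) end.
rewrite Rabs_div by auto. apply Rmult_lt_reg_r with (Rabs h); auto.
match goal with |- ?A / ?B * _ < _ => replace (A / B * B) with A by (field; lra) end.
eapply Rle_lt_trans; [exact Hd|]. rewrite <- (pow2_abs h).
apply Rle_lt_trans with (Rabs h * (Rabs h * (16 * PI))); [right; ring|].
rewrite Rmult_comm. apply Rmult_lt_compat_r; auto.
apply Rlt_le_trans with (eps / (16 * PI + 1) * (16 * PI + 1)); [|right; field; lra]. nra.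
Qed.

(** The transform satisfies I' = - t I, so I(t) exp (t^2 / 2) is constant. *)
Lemma Int_gauss_cos t : Int (fun x => exp (- x ^ 2 / 2) * cos (t * x)) = sqrt (2 * PI) * exp (- t ^ 2 / 2).
Proof.
set (I := fun t => Int (fun x => exp (- x ^ 2 / 2) * cos (t * x))). change (I t = sqrt (2 * PI) * exp (- t ^ 2 / 2)).
assert (H : forall t, is_derive (fun t => I t * exp (t ^ 2 / 2)) t 0).
{ intros u. pose proof (is_derive_gauss_cos u) as D. fold (I u) in D.
  assert (D2 : is_derive (fun t => exp (t ^ 2 / 2)) u (u * exp (u ^ 2 / 2))) by (auto_derive; auto; unfold Rdiv; simpl; field).
  pose proof (is_derive_mult _ _ _ _ _ D D2 Rmult_comm) as D3.
  replace 0 with (plus (mult (- (u * I u)) (exp (u ^ 2 / 2))) (mult (I u) (u * exp (u ^ 2 / 2)))).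
  exact D3. unfold plus, mult; simpl; unfold mult; simpl; ring. }
pose proof (RInt_FTC _ (fun _ => 0) 0 t H ltac:(solve_cont)) as E.
rewrite (RInt_const (V := R_CompleteNormedModule)) in E.
change (scal (t - 0) 0) with ((t - 0) * 0) in E. rewrite Rmult_0_r in E.
assert (E0 : I 0 = sqrt (2 * PI)).
{ rewrite <- Int_gauss. apply Int_ext; intros x. rewrite Rmult_0_l, cos_0; ring. }
rewrite E0 in E. replace (0 ^ 2 / 2) with 0 in E by field. rewrite exp_0 in E.
replace (- t ^ 2 / 2) with (- (t ^ 2 / 2)) by field. rewrite exp_Ropp.
pose proof (exp_pos (t ^ 2 / 2)). apply Rmult_eq_reg_r with (exp (t ^ 2 / 2)); [|lra].
rewrite Rmult_assoc, Rinv_l by lra. lra.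
Qed.

(** * The complex Gamma function *)

(* Gamma(a + i y), after the substitution t = e^v. *)
Definition GammaC (a y : R) : C := CInt (fun v => cexp (a * v - exp v) (y * v)).

Lemma cquad_decay_GammaC a y : 0 < a -> cquad_decay (fun v => cexp (a * v - exp v) (y * v)).
Proof.
intros Ha; split.
- split; unfold cexp; simpl; solve_cont.
- destruct (gexp_qbound a Ha) as [K HK]. exists K; intros v. now rewrite Cmod_cexp.
Qed.
Local Hint Resolve cquad_decay_GammaC : core.

Lemma GammaC_bound a : 0 < a -> exists K, forall y, Cmod (GammaC a y) <= K.
Proof.
intros Ha. destruct (gexp_qbound a Ha) as [K HK]. exists (2 * PI * K); intros y.
apply CInt_bound; [apply cquad_decay_GammaC; auto|]. intros v; now rewrite Cmod_cexp.
Qed.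

Lemma ccont_GammaC a : 0 < a -> ccont (fun y => GammaC a y).
Proof.
intros Ha. destruct (gexp_qbound a Ha) as [K HK].
apply (CInt_param_cont (fun v y => cexp (a * v - exp v) (y * v)) K).
- split; unfold cexp; simpl; solve_cont2.
- intros v y; now rewrite Cmod_cexp.
Qed.

(** The derivative in v of the kernel for a is (a + i y) times that kernel minus the kernel for a +
    1, and the integral of a derivative of a decaying function vanishes. *)
Lemma GammaC_rec a y : 0 < a -> GammaC (a + 1) y = Cmult (a, y) (GammaC a y).
Proof.
intros Ha. unfold GammaC.
assert (Ha1 : 0 < a + 1) by lra.
rewrite <- CInt_scal by auto.
assert (E : Cminus (CInt (fun v => Cmult (a, y) (cexp (a * v - exp v) (y * v))))
  (CInt (fun v => cexp ((a + 1) * v - exp v) (y * v))) = RtoC 0).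
{ rewrite <- CInt_minus by auto using cquad_decay_scal.
  apply CInt_derive0 with (fun v => cexp (a * v - exp v) (y * v)); auto.
  - intros v. unfold cexp, Cminus, Cplus, Copp, Cmult; simpl.
    auto_derive; auto. replace ((a + 1) * v - exp v) with ((a * v - exp v) + v) by ring.
    rewrite (exp_plus (a * v - exp v) v). unfold Rminus. ring.
  - intros v. unfold cexp, Cminus, Cplus, Copp, Cmult; simpl.
    auto_derive; auto. replace ((a + 1) * v - exp v) with ((a * v - exp v) + v) by ring.
    rewrite (exp_plus (a * v - exp v) v). unfold Rminus. ring.
  - apply (cquad_decay_minus (fun v => Cmult (a, y) (cexp (a * v - exp v) (y * v)))
      (fun v => cexp ((a + 1) * v - exp v) (y * v))); auto using cquad_decay_scal. }
symmetry. revert E. generalize (CInt (fun v => Cmult (a, y) (cexp (a * v - exp v) (y * v)))).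
intros z E. replace z with (Cplus (RtoC 0) (CInt (fun v => cexp ((a + 1) * v - exp v) (y * v)))); [ring|].
rewrite <- E; ring.
Qed.

Lemma Cmod_sq a y : Cmod (a, y) ^ 2 = a ^ 2 + y ^ 2.
Proof. unfold Cmod; simpl fst; simpl snd. apply pow2_sqrt. nra. Qed.

(** Two steps of the functional equation, with |a + 1 + i y| >= |a + i y|. A bound on the line
    through a + 2 thus gains a factor 1 / (1 + y^2) on the line through a. *)
Lemma GammaC_gain a y : 0 < a -> (a ^ 2 + y ^ 2) * Cmod (GammaC a y) <= Cmod (GammaC (a + 2) y).
Proof.
intros Ha. replace (a + 2) with (a + 1 + 1) by ring.
rewrite !GammaC_rec, !Cmod_mult by lra. rewrite <- Rmult_assoc.
apply Rmult_le_compat_r; [apply Cmod_ge_0|]. rewrite <- Cmod_sq.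
simpl; rewrite Rmult_1_r. apply Rmult_le_compat_r; [apply Cmod_ge_0|].
unfold Cmod; simpl fst; simpl snd. apply sqrt_le_1_alt. nra.
Qed.

Lemma GammaC_gain' a y : 0 < a -> Cmod (GammaC a y) <= (1 + / a ^ 2) / (1 + y ^ 2) * Cmod (GammaC (a + 2) y).
Proof.
intros Ha. pose proof (GammaC_gain a y Ha) as H. pose proof (one_plus_sq_pos y) as Hy.
assert (Hs : 0 < a ^ 2 + y ^ 2) by nra.
apply Rmult_le_reg_l with (a ^ 2 + y ^ 2); auto. eapply Rle_trans; [exact H|].
rewrite <- Rmult_assoc. rewrite <- (Rmult_1_l (Cmod (GammaC (a + 2) y))) at 1.
apply Rmult_le_compat_r; [apply Cmod_ge_0|].
apply Rmult_le_reg_r with (1 + y ^ 2); auto. assert (Ha2 : 0 < a ^ 2) by nra.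
replace ((a ^ 2 + y ^ 2) * ((1 + / a ^ 2) / (1 + y ^ 2)) * (1 + y ^ 2)) with
  ((a ^ 2 + y ^ 2) * (1 + / a ^ 2)) by (field; lra).
assert (0 < / a ^ 2) by now apply Rinv_0_lt_compat.
replace ((a ^ 2 + y ^ 2) * (1 + / a ^ 2)) with (1 + y ^ 2 + a ^ 2 + y ^ 2 * / a ^ 2) by (field; lra).
nra.
Qed.

Lemma GammaC_decay a : 0 < a -> exists K, 0 <= K /\ forall y, Cmod (GammaC a y) <= K / (1 + y ^ 2).
Proof.
intros Ha. destruct (GammaC_bound (a + 2)) as [K HK]; [lra|].
assert (0 <= K) by (eapply Rle_trans; [apply (Cmod_ge_0 (GammaC (a + 2) 0))|apply HK]).
assert (0 < 1 + / a ^ 2) by (assert (0 < / a ^ 2) by (apply Rinv_0_lt_compat; nra); lra).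
exists ((1 + / a ^ 2) * K); split; [apply Rmult_le_pos; lra|]. intros y.
eapply Rle_trans; [now apply GammaC_gain'|]. pose proof (one_plus_sq_pos y).
replace ((1 + / a ^ 2) * K / (1 + y ^ 2)) with ((1 + / a ^ 2) / (1 + y ^ 2) * K) by (field; split; nra).
apply Rmult_le_compat_l; auto. apply Rdiv_le_0_compat; lra.
Qed.

(** The gain applied once more: the Fourier inversion below spends one factor 1 / (1 + y^2) on
    removing its Gaussian regularization. *)
Lemma GammaC_decay2 a : 0 < a -> exists K, 0 <= K /\ forall y, Cmod (GammaC a y) <= K / (1 + y ^ 2) ^ 2.
Proof.
intros Ha. destruct (GammaC_decay (a + 2)) as [K [HK0 HK]]; [lra|].
assert (0 < 1 + / a ^ 2) by (assert (0 < / a ^ 2) by (apply Rinv_0_lt_compat; nra); lra).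
exists ((1 + / a ^ 2) * K); split; [apply Rmult_le_pos; lra|]. intros y.
eapply Rle_trans; [now apply GammaC_gain'|]. pose proof (one_plus_sq_pos y).
replace ((1 + / a ^ 2) * K / (1 + y ^ 2) ^ 2) with ((1 + / a ^ 2) / (1 + y ^ 2) * (K / (1 + y ^ 2)))
  by (field; split; nra).
apply Rmult_le_compat_l; auto. apply Rdiv_le_0_compat; lra.
Qed.

Lemma cquad_decay_GammaC_y a : 0 < a -> cquad_decay (fun y => GammaC a y).
Proof.
intros Ha; split; [now apply ccont_GammaC|]. destruct (GammaC_decay a Ha) as [K [_ HK]]; now exists K.
Qed.

Lemma GammaC_real a : 0 < a -> GammaC a 0 = RtoC (Int (fun v => exp (a * v - exp v))).
Proof.
intros Ha. unfold GammaC, CInt, RtoC, cexp; simpl. f_equal.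
- apply Int_ext; intros v. rewrite Rmult_0_l, cos_0; ring.
(* The zero function is written as 0 times a Gaussian so that [Int_scal] applies. *)
- rewrite (Int_ext _ (fun v => 0 * exp (- v ^ 2 / 2))) by (intros; rewrite Rmult_0_l, sin_0; ring).
  rewrite Int_scal by apply quad_decay_gauss. ring.
Qed.

Definition GammaR a := Int (fun v => exp (a * v - exp v)).

Lemma quad_decay_GammaR a : 0 < a -> quad_decay (fun v => exp (a * v - exp v)).
Proof.
intros Ha; split; [solve_cont|]. destruct (gexp_qbound a Ha) as [K HK]. exists K; intros v.
rewrite Rabs_right; auto. left; apply exp_pos.
Qed.
Local Hint Resolve quad_decay_GammaR : core.

Lemma GammaR_pos a : 0 < a -> 0 < GammaR a.
Proof. intros Ha; apply Int_pos; auto. intros; apply exp_pos. Qed.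

Lemma GammaR_rec a : 0 < a -> GammaR (a + 1) = a * GammaR a.
Proof.
intros Ha. pose proof (GammaC_rec a 0 Ha) as H. rewrite !GammaC_real in H by lra.
apply (f_equal fst) in H. simpl in H. rewrite Rmult_0_l, Rminus_0_r in H. exact H.
Qed.

(** * Gamma has no zeros on the right half-plane *)

Lemma cos_ge_quad d : 1 - d ^ 2 / 2 <= cos d.
Proof.
replace d with (2 * (d / 2)) at 2 by field. rewrite cos_2a_sin.
pose proof (sin_lip (d / 2) 0) as H. rewrite sin_0, !Rminus_0_r in H.
apply pow_maj_Rabs with (n := 2%nat) in H. rewrite pow2_abs in H. nra.
Qed.

(** Replaces a square of the logarithm by exponentials, whose integrals against exp (a v - e^v) are
    again Gamma values. It follows from the mean value theorem applied to the difference and to its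
    derivative. *)
Lemma sq_le_cosh d : d ^ 2 <= exp d - 2 + exp (- d).
Proof.
assert (H : forall r, 0 <= r -> r ^ 2 <= exp r - 2 + exp (- r)).
{ intros r Hr.
  assert (D : forall x, 0 <= x -> 2 * x <= exp x - exp (- x)).
  { intros x Hx. destruct (MVT_gen (fun x => exp x - exp (- x) - 2 * x) 0 x
      (fun x => exp x + exp (- x) - 2)) as [c [Hc E]].
    - intros z _. auto_derive; auto. ring.
    - intros z _. solve_cont.
    - assert (0 <= exp c + exp (- c) - 2).
      { assert (exp c * exp (- c) = 1) by (rewrite <- exp_plus, Rplus_opp_r; apply exp_0).
        pose proof (exp_pos c); pose proof (exp_pos (- c)). pose proof (pow2_ge_0 (exp c - exp (- c))). nra. }
      rewrite Ropp_0, exp_0 in E.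
      assert (0 <= (exp c + exp (- c) - 2) * (x - 0)) by (apply Rmult_le_pos; lra). lra. }
  destruct (MVT_gen (fun x => exp x + exp (- x) - x ^ 2) 0 r
      (fun x => exp x - exp (- x) - 2 * x)) as [c [Hc E]].
  - intros z _. auto_derive; auto. ring.
  - intros z _. solve_cont.
  - rewrite Ropp_0, exp_0 in E. rewrite Rmin_left, Rmax_right in Hc by lra.
    specialize (D c ltac:(lra)).
    assert (0 <= (exp c - exp (- c) - 2 * c) * (r - 0)) by (apply Rmult_le_pos; lra). nra. }
destruct (Rle_dec 0 d); [auto|].
specialize (H (- d) ltac:(lra)). rewrite Ropp_involutive in H. nra.
Qed.

(* |Gamma(x + 1 + i y)| >= Gamma(x + 1) (1 - y^2 / (2 x)): the modulus is that of the
   characteristic function at y of log T, T ~ Gamma(x + 1), bounded through its second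
   moment about log (x + 1). *)
Lemma GammaC_neq0_large x y : 0 < x -> y ^ 2 < 2 * x -> GammaC (x + 1) y <> RtoC 0.
Proof.
intros Hx Hy H.
set (m := ln (x + 1)). assert (Hm : exp m = x + 1) by (apply exp_ln; lra).
assert (Hx1 : 0 < x + 1) by lra.
(* Multiplication by the phase e^(- i y m) centres the cosine at m = ln (x + 1). *)
assert (E : fst (Cmult (cexp 0 (- (y * m))) (GammaC (x + 1) y)) =
   Int (fun v => exp ((x + 1) * v - exp v) * cos (y * (v - m)))).
{ unfold GammaC. rewrite <- CInt_scal by auto.
  change (Int (fun v => fst (Cmult (cexp 0 (- (y * m))) (cexp ((x + 1) * v - exp v) (y * v)))) =
   Int (fun v => exp ((x + 1) * v - exp v) * cos (y * (v - m)))).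
  apply Int_ext; intros v. rewrite cexp_mult. unfold cexp; simpl.
  replace (0 + ((x + 1) * v - exp v)) with ((x + 1) * v - exp v) by ring.
  f_equal. f_equal; ring. }
rewrite H, Cmult_0_r in E. simpl in E.
set (w := fun v => exp ((x + 1) * v - exp v)).
(* Obtained from cos (y d) >= 1 - (y^2 / 2) (e^d - 2 + e^(- d)) with d = v - m and e^m = x + 1. The
   three terms integrate to multiples of Gamma at x + 1, x + 2 and x, with sum Gamma(x) (x - y^2 /
   2) > 0. *)
set (lo := fun v => (1 + y ^ 2) * w v + (- (y ^ 2 / 2 / (x + 1))) * exp ((x + 1 + 1) * v - exp v)
   + (- (y ^ 2 / 2 * (x + 1))) * exp (x * v - exp v)).
assert (Hlo : forall v, lo v <= w v * cos (y * (v - m))).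
{ intros v. unfold lo.
  replace (exp ((x + 1 + 1) * v - exp v)) with (w v * exp v)
    by (unfold w; rewrite <- exp_plus; f_equal; ring).
  replace (exp (x * v - exp v)) with (w v * exp (- v))
    by (unfold w; rewrite <- exp_plus; f_equal; ring).
  replace (_ + _ + _) with (w v * (1 - y ^ 2 / 2 * (exp v / (x + 1) - 2 + (x + 1) * exp (- v))))
    by (field; lra).
  apply Rmult_le_compat_l; [left; apply exp_pos|].
  pose proof (cos_ge_quad (y * (v - m))) as Hc. pose proof (sq_le_cosh (v - m)) as Hs.
  replace (exp (v - m)) with (exp v / (x + 1)) in Hs
    by (unfold Rminus; rewrite exp_plus, exp_Ropp, Hm; reflexivity).
  replace (exp (- (v - m))) with ((x + 1) * exp (- v)) in Hs
    by (rewrite <- Hm, <- exp_plus; f_equal; ring).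
  rewrite Rpow_mult_distr in Hc. pose proof (pow2_ge_0 y). nra. }
assert (Q1 : quad_decay w) by (apply quad_decay_GammaR; lra).
assert (Q2 : quad_decay (fun v => exp ((x + 1 + 1) * v - exp v))) by (apply quad_decay_GammaR; lra).
assert (Q3 : quad_decay (fun v => exp (x * v - exp v))) by (apply quad_decay_GammaR; lra).
assert (HI : Int lo <= 0).
{ rewrite E. apply Int_le; auto.
  - unfold lo. auto using quad_decay_plus, quad_decay_scal.
  - apply quad_decay_bounded_mult with 1; auto; [solve_cont|intros; apply Rabs_cos_le]. }
unfold lo in HI. rewrite !Int_plus, !Int_scal in HI by auto using quad_decay_plus, quad_decay_scal.
change (Int w) with (GammaR (x + 1)) in HI.
change (Int (fun v => exp ((x + 1 + 1) * v - exp v))) with (GammaR (x + 1 + 1)) in HI.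
change (Int (fun v => exp (x * v - exp v))) with (GammaR x) in HI.
rewrite !GammaR_rec in HI by lra. pose proof (GammaR_pos x Hx) as Hp.
replace (_ + _ + _) with (GammaR x * (x - y ^ 2 / 2)) in HI by (field; lra). nra.
Qed.

Lemma GammaC_neq0 a y : 0 < a -> GammaC a y <> RtoC 0.
Proof.
intros Ha H.
(* The functional equation carries a zero to all translates a + n, and for large n these lie in the
   range of [GammaC_neq0_large]. *)
assert (Hn : forall n, GammaC (a + INR n) y = RtoC 0).
{ induction n as [|n IH].
  - simpl; now rewrite Rplus_0_r.
  - rewrite S_INR, <- Rplus_assoc, GammaC_rec, IH by (pose proof (pos_INR n); lra). ring. }
destruct (INR_unbounded (y ^ 2)) as [N HN].
apply (GammaC_neq0_large (a + INR N) y).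
- pose proof (pos_INR N); lra.
- pose proof (pow2_ge_0 y); lra.
- replace (a + INR N + 1) with (a + INR (S N)) by (rewrite S_INR; ring). apply Hn.
Qed.

(** * Fourier inversion *)

Lemma ccont_RtoC f : continuity f -> ccont (fun x => RtoC (f x)).
Proof. intros H; split; simpl; auto. intros x; apply continuity_pt_const; intros a b; auto. Qed.

Lemma cquad_decay_RtoC f : quad_decay f -> cquad_decay (fun x => RtoC (f x)).
Proof.
intros [Hf [K HK]]; split; [now apply ccont_RtoC|]. exists K; intros x; now rewrite Cmod_R.
Qed.

Lemma CInt_of_R f : CInt (fun x => RtoC (f x)) = RtoC (Int f).
Proof.
unfold CInt, RtoC; simpl; f_equal. apply (Int_unique _ (Finite 0)).
apply is_lim_seq_ext with (fun _ => 0); [|apply is_lim_seq_const].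
intros n. rewrite (RInt_const (V := R_CompleteNormedModule)). symmetry; apply Rmult_0_r.
Qed.

Lemma cquad_decay_gauss_cexp t : cquad_decay (fun x => cexp (- x ^ 2 / 2) (t * x)).
Proof.
split; [split; unfold cexp; cbn [fst snd]; solve_cont|].
destruct quad_decay_gauss as [_ [K HK]]. exists K; intros x. rewrite Cmod_cexp.
eapply Rle_trans; [apply Rle_abs|apply HK].
Qed.

Lemma CInt_gauss_cexp t : CInt (fun x => cexp (- x ^ 2 / 2) (t * x)) = RtoC (sqrt (2 * PI) * exp (- t ^ 2 / 2)).
Proof.
unfold CInt, cexp, RtoC; cbn [fst snd]. rewrite Int_gauss_cos. f_equal.
apply Int_odd.
- apply quad_decay_bounded_mult with 1; [apply quad_decay_gauss|solve_cont|intros; apply Rabs_sin_le].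
- intros x; cbv beta. replace (- (- x) ^ 2) with (- x ^ 2) by ring.
  replace (t * - x) with (- (t * x)) by ring. rewrite sin_neg; ring.
Qed.

Lemma CInt_gauss_cexp_scaled d u : 0 < d ->
  CInt (fun y => cexp (- (d * y) ^ 2 / 2) (y * u)) =
  RtoC (sqrt (2 * PI) / d * exp (- (u / d) ^ 2 / 2)).
Proof.
intros Hd. pose proof (CInt_affine _ d 0 ltac:(lra) (cquad_decay_gauss_cexp (u / d))) as H.
cbv beta in H. rewrite CInt_gauss_cexp, Rabs_right in H by lra.
rewrite (CInt_ext _ (fun y => cexp (- (d * y) ^ 2 / 2) (y * u))) in H.
2:{ intros y; rewrite Rplus_0_r; f_equal. field; lra. }
replace (RtoC (sqrt (2 * PI) / d * exp (- (u / d) ^ 2 / 2)))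
  with (Cmult (RtoC (/ d)) (RtoC (sqrt (2 * PI) * exp (- (u / d) ^ 2 / 2)))).
- rewrite <- H, Cmult_assoc, <- RtoC_mult, Rinv_l by lra. now rewrite Cmult_1_l.
- rewrite <- RtoC_mult; f_equal; field; lra.
Qed.

Lemma ccont2_RtoC f : cont2 f -> ccont2 (fun x y => RtoC (f x y)).
Proof. intros H; split; [exact H|]. exact (fun x y => continuity_2d_pt_const x y 0). Qed.

Section Inversion.
Variables (phi : R -> R) (L K Kp v0 : R).
Hypothesis Hphi : continuity phi.
Hypothesis HKp : forall v, Rabs (phi v) <= Kp / (1 + v ^ 2).
Hypothesis Hlip : forall x y, Rabs (phi x - phi y) <= L * Rabs (x - y).
Let F y := CInt (fun v => Cmult (RtoC (phi v)) (cexp 0 (y * v))).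
Hypothesis HK : forall y, Cmod (F y) <= K / (1 + y ^ 2) ^ 2.

Let X := CInt (fun y => Cmult (F y) (cexp 0 (- (y * v0)))).
(** [X] with a Gaussian summability factor. As d tends to 0, [A d] is compared with [X] on one side
    and with 2 PI phi(v0) on the other, both with error O(d). *)
Let A d := CInt (fun y => Cmult (Cmult (F y) (cexp 0 (- (y * v0)))) (RtoC (exp (- (d * y) ^ 2 / 2)))).

Let ccont2_kernel : ccont2 (fun v y => Cmult (RtoC (phi v)) (cexp 0 (y * v))).
Proof.
apply ccont2_mult; [apply (ccont2_of_l (fun v => RtoC (phi v))), ccont_RtoC; auto|].
split; unfold cexp; simpl; solve_cont2.
Qed.

Let HF : ccont F.
Proof.
apply (CInt_param_cont (fun v y => Cmult (RtoC (phi v)) (cexp 0 (y * v))) Kp); auto.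
intros v y. rewrite Cmod_mult, Cmod_cexp, exp_0, Rmult_1_r, Cmod_R; auto.
Qed.

Let HX : cquad_decay (fun y => Cmult (F y) (cexp 0 (- (y * v0)))).
Proof.
split; [apply ccont_mult; auto; split; unfold cexp; simpl; solve_cont|].
exists K; intros y. rewrite Cmod_mult, Cmod_cexp, exp_0, Rmult_1_r.
eapply Rle_trans; [apply HK|]. pose proof (one_plus_sq_pos y).
assert (0 <= K).
{ specialize (HK 0). pose proof (Cmod_ge_0 (F 0)).
  replace (K / (1 + 0 ^ 2) ^ 2) with K in HK by (field; lra). lra. }
unfold Rdiv; apply Rmult_le_compat_l; auto. apply Rinv_le_contravar; nra.
Qed.

Let quad_decay_phi : quad_decay phi.
Proof. split; eauto. Qed.

(** Fubini lets the Gaussian transform act first; after v = d w + v0 it is an approximate identity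
    at v0. The domination uses d <= 1 through d^2 (1 + y^2) <= (1 + (d y)^2)^2. *)
Let A_gauss d : 0 < d <= 1 ->
  A d = RtoC (sqrt (2 * PI) * Int (fun w => phi (d * w + v0) * exp (- w ^ 2 / 2))).
Proof.
intros Hd.
assert (E1 : A d = CInt (fun y => CInt (fun v =>
   Cmult (RtoC (phi v)) (cexp (- (d * y) ^ 2 / 2) (y * (v - v0)))))).
{ apply CInt_ext; intros y. unfold F. rewrite RtoC_exp.
  rewrite Cmult_comm, (Cmult_comm (CInt _)), Cmult_assoc, cexp_mult, <- CInt_scal.
  - apply CInt_ext; intros v. rewrite Cmult_assoc, (Cmult_comm (cexp _ _) (RtoC _)), <- Cmult_assoc, cexp_mult.
    f_equal. f_equal; ring.
  - split.
    + apply ccont_mult; [now apply ccont_RtoC|]. split; unfold cexp; simpl; solve_cont.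
    + exists Kp; intros v. rewrite Cmod_mult, Cmod_cexp, exp_0, Rmult_1_r, Cmod_R; auto. }
assert (Hd2 : 0 < d ^ 2) by nra.
assert (HKp0 : 0 <= Kp) by (now apply quad_decay_K_nonneg with phi).
rewrite E1. rewrite (CInt_Fubini (fun y v => Cmult (RtoC (phi v)) (cexp (- (d * y) ^ 2 / 2) (y * (v - v0))))
   (Kp * (16 / d ^ 2))).
2:{ apply ccont2_mult; [apply (ccont2_of_r (fun v => RtoC (phi v))), ccont_RtoC; auto|].
    split; unfold cexp, Rdiv; simpl; solve_cont2. }
2:{ intros y v. rewrite Cmod_mult, Cmod_cexp, Cmod_R.
    pose proof (one_plus_sq_pos v); pose proof (one_plus_sq_pos y); pose proof (one_plus_sq_pos (d * y)).
    replace (Kp * (16 / d ^ 2) / _) with (Kp / (1 + v ^ 2) * (16 / d ^ 2 / (1 + y ^ 2))) by (field; repeat split; lra).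
    apply Rmult_le_compat; auto using Rabs_pos; [left; apply exp_pos|].
    eapply Rle_trans; [apply gauss_bound|].
    replace (16 / d ^ 2 / (1 + y ^ 2)) with (16 * / (d ^ 2 * (1 + y ^ 2))) by (field; lra).
    unfold Rdiv; apply Rmult_le_compat_l; [lra|]. apply Rinv_le_contravar; [nra|].
    rewrite Rpow_mult_distr. pose proof (pow2_ge_0 y).
    assert (d ^ 2 <= 1) by nra. assert (0 <= d ^ 2 * y ^ 2) by nra. nra. }
rewrite (CInt_ext _ (fun v => RtoC ((sqrt (2 * PI) / d) * (phi v * exp (- ((v - v0) / d) ^ 2 / 2))))).
2:{ intros v. rewrite CInt_scal, CInt_gauss_cexp_scaled, <- RtoC_mult; [f_equal; ring|lra|].
    split; [split; unfold cexp; cbn [fst snd]; solve_cont|].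
    destruct (cquad_decay_affine _ d 0 ltac:(lra) (cquad_decay_gauss_cexp 0)) as [_ [k Hk]]. exists k; intros y.
    rewrite Cmod_cexp. specialize (Hk y). rewrite Cmod_cexp, Rplus_0_r in Hk. exact Hk. }
rewrite CInt_of_R. f_equal.
set (f := fun v => phi v * exp (- ((v - v0) / d) ^ 2 / 2)).
assert (Hq : quad_decay f).
{ apply quad_decay_bounded_mult with 1; auto; [solve_cont; lra|].
  intros v. rewrite Rabs_right by (left; apply exp_pos). rewrite <- exp_0. apply exp_le.
  pose proof (pow2_ge_0 ((v - v0) / d)). lra. }
transitivity (Int (fun v => sqrt (2 * PI) / d * f v)); [reflexivity|]. rewrite (Int_scal (sqrt (2 * PI) / d) f) by auto. rewrite <- (Int_affine_pos f d v0) by (auto; lra).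
unfold f. rewrite (Int_ext _ (fun w => phi (d * w + v0) * exp (- w ^ 2 / 2))).
- field; lra.
- intros w. do 2 f_equal. field; lra.
Qed.

(** Since |exp (- (d y)^2 / 2) - 1| <= d (1 + y^2), one of the two decay factors of F is spent and
    the other keeps the integral finite. *)
Let A_near_X d : 0 < d <= 1 -> Cmod (Cminus (A d) X) <= 2 * PI * K * d.
Proof.
intros Hd. unfold A, X.
set (h := fun y => Cmult (F y) (cexp 0 (- (y * v0)))).
assert (HK0 : 0 <= K).
{ specialize (HK 0). pose proof (Cmod_ge_0 (F 0)).
  replace (K / (1 + 0 ^ 2) ^ 2) with K in HK by (field; lra). lra. }
assert (Hg : ccont (fun y => RtoC (exp (- (d * y) ^ 2 / 2)))) by (apply ccont_RtoC; solve_cont).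
assert (Hc : cquad_decay (fun y => Cmult (h y) (RtoC (exp (- (d * y) ^ 2 / 2))))).
{ split; [apply ccont_mult; auto; apply HX|].
  destruct HX as [_ [k Hk]]. exists k; intros y. rewrite Cmod_mult, Cmod_R.
  eapply Rle_trans; [|apply Hk]. rewrite <- (Rmult_1_r (Cmod (Cmult (F y) _))).
  apply Rmult_le_compat_l; [apply Cmod_ge_0|]. rewrite Rabs_right by (left; apply exp_pos).
  rewrite <- exp_0. apply exp_le. pose proof (pow2_ge_0 (d * y)). lra. }
rewrite <- CInt_minus by auto. rewrite Rmult_assoc. apply CInt_bound.
- apply (cquad_decay_minus (fun y => Cmult (h y) (RtoC (exp (- (d * y) ^ 2 / 2)))) h); auto.
- intros y. replace (Cminus _ _) with (Cmult (h y) (RtoC (exp (- (d * y) ^ 2 / 2) - 1)))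
    by (unfold h; rewrite RtoC_minus; ring).
  unfold h. rewrite !Cmod_mult, Cmod_cexp, exp_0, Rmult_1_r, Cmod_R.
  pose proof (one_plus_sq_pos y).
  apply Rle_trans with (K / (1 + y ^ 2) ^ 2 * (d * (1 + y ^ 2))); [|right; field; lra].
  apply Rmult_le_compat; auto using Cmod_ge_0, Rabs_pos.
  assert (exp (- (d * y) ^ 2 / 2) <= 1).
  { rewrite <- exp_0. apply exp_le. pose proof (pow2_ge_0 (d * y)). lra. }
  rewrite Rabs_left1 by lra. pose proof (exp_ineq1_le (- (d * y) ^ 2 / 2)) as He.
  rewrite Rpow_mult_distr in *. pose proof (pow2_ge_0 y).
  assert (d ^ 2 <= d) by nra. assert (d ^ 2 * y ^ 2 <= d * y ^ 2) by (apply Rmult_le_compat_r; lra). nra.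
Qed.

(** The Lipschitz condition bounds the difference of the values of phi by L d |w|, with |w| <= 1 +
    w^2 absorbed by the Gaussian. *)
Let gauss_near_phi d : 0 < d <= 1 ->
  Rabs (Int (fun w => phi (d * w + v0) * exp (- w ^ 2 / 2)) - sqrt (2 * PI) * phi v0) <= 16 * L * d * PI.
Proof.
intros Hd. rewrite <- Int_gauss, (Rmult_comm _ (phi v0)), <- Int_scal by apply quad_decay_gauss.
assert (HL : 0 <= L).
{ specialize (Hlip 1 0). pose proof (Rabs_pos (phi 1 - phi 0)).
  rewrite Rminus_0_r, Rabs_R1 in Hlip. lra. }
assert (Hq : quad_decay (fun w => phi (d * w + v0) * exp (- w ^ 2 / 2))).
{ apply quad_decay_bounded_mult with 1; [apply quad_decay_affine; auto; lra|solve_cont|].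
  intros v. rewrite Rabs_right by (left; apply exp_pos). rewrite <- exp_0. apply exp_le.
  pose proof (pow2_ge_0 v). lra. }
rewrite <- Int_minus by auto using quad_decay_scal, quad_decay_gauss.
apply Int_bound.
- apply (quad_decay_minus (fun w => phi (d * w + v0) * exp (- w ^ 2 / 2))); auto using quad_decay_scal, quad_decay_gauss.
- intros w. rewrite <- Rmult_minus_distr_r, Rabs_mult, (Rabs_right (exp _)) by (left; apply exp_pos).
  pose proof (one_plus_sq_pos w).
  apply Rle_trans with (L * d * (1 + w ^ 2) * (16 / (1 + w ^ 2) ^ 2)); [|right; field; lra].
  apply Rmult_le_compat; auto using Rabs_pos; [left; apply exp_pos| |apply gauss_bound].
  eapply Rle_trans; [apply Hlip|]. replace (d * w + v0 - v0) with (d * w) by ring.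
  rewrite Rabs_mult, (Rabs_right d) by lra. rewrite Rmult_assoc.
  apply Rmult_le_compat_l; auto. apply Rmult_le_compat_l; [lra|].
  apply Rabs_le; nra.
Qed.

Lemma Fourier_inversion : X = RtoC (2 * PI * phi v0).
Proof.
set (M := 2 * PI * K + sqrt (2 * PI) * (16 * L * PI)).
assert (Hb : forall d, 0 < d <= 1 -> Cmod (Cminus X (RtoC (2 * PI * phi v0))) <= M * d).
{ intros d Hd. pose proof (A_near_X d Hd) as H1. pose proof (gauss_near_phi d Hd) as H2.
  rewrite (A_gauss d Hd) in H1. pose proof PI_RGT_0.
  set (I := Int (fun w => phi (d * w + v0) * exp (- w ^ 2 / 2))) in *.
  replace (Cminus X _) with (Cplus (Copp (Cminus (RtoC (sqrt (2 * PI) * I)) X))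
     (RtoC (sqrt (2 * PI) * (I - sqrt (2 * PI) * phi v0)))).
  - eapply Rle_trans; [apply Cmod_triangle|]. rewrite Cmod_opp, Cmod_R, Rabs_mult.
    rewrite (Rabs_right (sqrt _)) by (apply Rle_ge, sqrt_pos). unfold M.
    pose proof (Rmult_le_compat_l _ _ _ (sqrt_pos (2 * PI)) H2). lra.
  - rewrite Rmult_minus_distr_l, <- Rmult_assoc, sqrt_sqrt by lra. rewrite RtoC_minus. ring. }
assert (H0 : Cmod (Cminus X (RtoC (2 * PI * phi v0))) = 0).
{ destruct (Rle_lt_or_eq_dec 0 _ (Cmod_ge_0 (Cminus X (RtoC (2 * PI * phi v0))))) as [H|H]; auto.
  exfalso. set (r := Cmod _) in *.
  assert (HM : 0 < M) by (specialize (Hb 1 ltac:(lra)); lra).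
  (* With this d the bound M d is at most r / 2, which contradicts r > 0. *)
  pose proof (Hb (Rmin 1 (r / (2 * M)))) as Hc.
  assert (0 < r / (2 * M)) by (apply Rdiv_lt_0_compat; lra).
  specialize (Hc ltac:(split; [apply Rmin_pos; lra|apply Rmin_l])).
  pose proof (Rmin_r 1 (r / (2 * M))).
  assert (M * Rmin 1 (r / (2 * M)) <= M * (r / (2 * M))) by (apply Rmult_le_compat_l; lra).
  replace (M * (r / (2 * M))) with (r / 2) in * by (field; lra). lra. }
apply Cmod_eq_0 in H0. replace X with (Cplus (Cminus X (RtoC (2 * PI * phi v0))) (RtoC (2 * PI * phi v0))) by ring.
rewrite H0; ring.
Qed.
End Inversion.

(** * Mellin transforms *)

Lemma gexp_lipschitz a : 0 < a -> exists L, forall x y,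
  Rabs (exp (a * x - exp x) - exp (a * y - exp y)) <= L * Rabs (x - y).
Proof.
intros Ha.
assert (Hb : forall b v, 0 < b -> exp (b * v - exp v) <= exp (2 * b ^ 2)).
{ intros b v Hb. eapply Rle_trans; [now apply gexp_bound|]. rewrite <- (Rmult_1_r (exp (2 * b ^ 2))) at 2.
  apply Rmult_le_compat_l; [left; apply exp_pos|]. rewrite <- exp_0. apply exp_le.
  pose proof (Rabs_pos v). nra. }
exists (a * exp (2 * a ^ 2) + exp (2 * (a + 1) ^ 2)). intros x y.
destruct (MVT_gen (fun v => exp (a * v - exp v)) y x
  (fun v => a * exp (a * v - exp v) - exp ((a + 1) * v - exp v))) as [c [_ E]].
- intros z _. auto_derive; auto. replace ((a + 1) * z - exp z) with ((a * z - exp z) + z) by ring.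
  rewrite (exp_plus (a * z - exp z) z). unfold Rminus; ring.
- intros z _. solve_cont.
- rewrite E, Rabs_mult. apply Rmult_le_compat_r; [apply Rabs_pos|].
  pose proof (Hb a c Ha). pose proof (Hb (a + 1) c ltac:(lra)).
  pose proof (exp_pos (a * c - exp c)). pose proof (exp_pos ((a + 1) * c - exp c)).
  apply Rabs_le. split; nra.
Qed.

Lemma GammaC_kernel a y : GammaC a y = CInt (fun v => Cmult (RtoC (exp (a * v - exp v))) (cexp 0 (y * v))).
Proof.
apply CInt_ext; intros v. rewrite RtoC_exp, cexp_mult. f_equal; ring.
Qed.

Lemma Mellin_inversion a v : 0 < a ->
  CInt (fun y => Cmult (GammaC a y) (cexp 0 (- (y * v)))) = RtoC (2 * PI * exp (a * v - exp v)).
Proof.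
intros Ha. destruct (gexp_lipschitz a Ha) as [L HL]. destruct (GammaC_decay2 a Ha) as [K [_ HK]].
destruct (quad_decay_GammaR a Ha) as [Hc [Kp HKp]].
rewrite <- (Fourier_inversion (fun v => exp (a * v - exp v)) L K Kp v Hc HKp HL).
- apply CInt_ext; intros y. now rewrite GammaC_kernel.
- intros y. rewrite <- GammaC_kernel. apply HK.
Qed.

(** * The Mellin transform of the sine *)

Lemma Rabs_sin_le_abs x : Rabs (sin x) <= Rabs x.
Proof. pose proof (sin_lip x 0) as H. now rewrite sin_0, !Rminus_0_r in H. Qed.

(** On the left |sin (tau x)| <= tau x leaves the exponent 2 c v, on the right |sin| <= 1 leaves (2
    c - 1) v. Both decay exactly in the strip 0 < c < 1/2. *)
Lemma sin_exp_bound tau c v : 0 < tau -> 0 < c < 1 / 2 ->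
  Rabs (sin (tau * exp v)) * exp ((2 * c - 1) * v) <=
  (1 + tau) * exp (- Rmin (2 * c) (1 - 2 * c) * Rabs v).
Proof.
intros Ht Hc. pose proof (Rmin_l (2 * c) (1 - 2 * c)). pose proof (Rmin_r (2 * c) (1 - 2 * c)).
set (e := Rmin _ _) in *. destruct (Rle_dec v 0) as [Hv|Hv].
- apply Rle_trans with (tau * exp v * exp ((2 * c - 1) * v)).
  + apply Rmult_le_compat_r; [left; apply exp_pos|]. eapply Rle_trans; [apply Rabs_sin_le_abs|].
    rewrite Rabs_right; [lra|]. apply Rle_ge, Rmult_le_pos; [lra|left; apply exp_pos].
  + rewrite Rmult_assoc, <- exp_plus. apply Rmult_le_compat; try lra; [left; apply exp_pos|].
    apply exp_le. rewrite Rabs_left1 by lra. nra.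
- apply Rmult_le_compat; [apply Rabs_pos|left; apply exp_pos| |].
  + pose proof (Rabs_sin_le (tau * exp v)); lra.
  + apply exp_le. rewrite Rabs_right by lra. nra.
Qed.

Lemma sin_exp_decay_pos c : 0 < c < 1 / 2 -> 0 < Rmin (2 * c) (1 - 2 * c).
Proof. intros; apply Rmin_pos; lra. Qed.

(* The Mellin transform int_0^oo sin(tau x) x^(2 s - 2) dx at s = c + i y. *)
Definition sin_Mellin tau c y := CInt (fun v => Cmult (RtoC (sin (tau * exp v))) (cexp ((2 * c - 1) * v) (2 * y * v))).

Lemma cquad_decay_sin_Mellin tau c y : 0 < tau -> 0 < c < 1 / 2 ->
  cquad_decay (fun v => Cmult (RtoC (sin (tau * exp v))) (cexp ((2 * c - 1) * v) (2 * y * v))).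
Proof.
intros Ht Hc. split.
- apply ccont_mult; [apply ccont_RtoC; solve_cont|split; unfold cexp; cbn [fst snd]; solve_cont].
- exists ((1 + tau) * (1 + 2 / Rmin (2 * c) (1 - 2 * c) ^ 2)); intros v.
  rewrite Cmod_mult, Cmod_cexp, Cmod_R. eapply Rle_trans; [now apply sin_exp_bound|].
  unfold Rdiv at 1; rewrite Rmult_assoc.
  apply Rmult_le_compat_l; [lra|]. now apply exp_abs_bound, sin_exp_decay_pos.
Qed.

Lemma sin_Mellin_bound tau c : 0 < tau -> 0 < c < 1 / 2 -> exists K, 0 <= K /\ forall y, Cmod (sin_Mellin tau c y) <= K.
Proof.
intros Ht Hc. pose proof (sin_exp_decay_pos c Hc) as He.
set (K := (1 + tau) * (1 + 2 / Rmin (2 * c) (1 - 2 * c) ^ 2)).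
assert (HK : forall y, Cmod (sin_Mellin tau c y) <= 2 * PI * K).
{ intros y. apply CInt_bound; [apply cquad_decay_sin_Mellin; auto|]. intros v.
  rewrite Cmod_mult, Cmod_cexp, Cmod_R. eapply Rle_trans; [now apply sin_exp_bound|].
  unfold K, Rdiv at 1; rewrite Rmult_assoc.
  apply Rmult_le_compat_l; [lra|]. now apply exp_abs_bound. }
exists (2 * PI * K); split; auto. eapply Rle_trans; [apply (Cmod_ge_0 (sin_Mellin tau c 0))|apply HK].
Qed.

Lemma ccont_sin_Mellin tau c : 0 < tau -> 0 < c < 1 / 2 -> ccont (fun y => sin_Mellin tau c y).
Proof.
intros Ht Hc.
apply (CInt_param_cont (fun v y => Cmult (RtoC (sin (tau * exp v))) (cexp ((2 * c - 1) * v) (2 * y * v)))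
  ((1 + tau) * (1 + 2 / Rmin (2 * c) (1 - 2 * c) ^ 2))).
- apply ccont2_mult; [apply ccont2_RtoC; solve_cont2|split; unfold cexp; cbn [fst snd]; solve_cont2].
- intros v y. rewrite Cmod_mult, Cmod_cexp, Cmod_R. eapply Rle_trans; [now apply sin_exp_bound|].
  unfold Rdiv at 1; rewrite Rmult_assoc.
  apply Rmult_le_compat_l; [lra|]. now apply exp_abs_bound, sin_exp_decay_pos.
Qed.

Lemma sin_exp2_eq r v tau : sin (tau * exp v) * exp (2 * v - exp (r + 2 * v)) =
  exp v * (exp v * sin (tau * exp v) * exp (- (exp r * exp v ^ 2))).
Proof.
assert (E : exp (r + 2 * v) = exp r * exp v ^ 2).
{ replace (r + 2 * v) with (r + (v + v)) by ring. rewrite (exp_plus r), (exp_plus v); ring. }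
rewrite E. replace (2 * v - exp r * exp v ^ 2) with (v + v + - (exp r * exp v ^ 2)) by ring.
rewrite (exp_plus (v + v)), (exp_plus v). ring.
Qed.

Lemma Int_sin_gauss_log tau r :
  Int (fun v => sin (tau * exp v) * exp (2 * v - exp (r + 2 * v))) =
  tau * sqrt PI / 4 * exp (- (3 / 2) * r - tau ^ 2 / 4 * exp (- r)).
Proof.
(* Chosen so that (k x)^2 / 2 = e^r x^2: in x = e^v the integral is that of x sin (tau x) exp (- e^r
   x^2) over the half-line, and scaling by k reduces it to the standard Gaussian. *)
set (k := sqrt 2 * exp (r / 2)).
assert (Hs : 0 < sqrt 2) by (apply sqrt_lt_R0; lra).
assert (Hs2 : sqrt 2 * sqrt 2 = 2) by (apply sqrt_sqrt; lra).
assert (Hk : 0 < k) by (apply Rmult_lt_0_compat; [auto|apply exp_pos]).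
assert (Hee : exp (r / 2) * exp (r / 2) = exp r) by (rewrite <- exp_plus; f_equal; field).
assert (Hk2 : k ^ 2 = 2 * exp r).
{ unfold k. rewrite Rpow_mult_distr. simpl. now rewrite !Rmult_1_r, Hs2, Hee. }
set (G := fun u => u * exp (- u ^ 2 / 2) * sin (tau / k * u)).
set (f := fun x => / k * G (k * x + 0)).
assert (Hf : forall x, f x = x * sin (tau * x) * exp (- (exp r * x ^ 2))).
{ intros x. unfold f, G. rewrite Rplus_0_r.
  replace (tau / k * (k * x)) with (tau * x) by (field; lra).
  replace (- (k * x) ^ 2 / 2) with (- (exp r * x ^ 2)) by (rewrite Rpow_mult_distr, Hk2; field).
  field; lra. }
assert (HG : quad_decay G) by apply quad_decay_xgauss_sin.
rewrite (Int_ext _ (fun v => exp v * f (exp v))) by (intros v; rewrite Hf; apply sin_exp2_eq).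
rewrite Int_even_log.
- unfold f. rewrite Int_scal by (apply quad_decay_affine; auto; lra).
  replace (Int (fun x => G (k * x + 0))) with (/ k * Int G).
  2:{ rewrite <- (Int_affine_pos G k 0) by auto. field; lra. }
  unfold G; rewrite Int_xgauss_sin, Int_gauss_cos.
  rewrite sqrt_mult by (try lra; left; apply PI_RGT_0).
  replace (- (tau / k) ^ 2 / 2) with (- (tau ^ 2 / 4 * exp (- r))).
  2:{ rewrite exp_Ropp. unfold Rdiv. rewrite Rpow_mult_distr, pow_inv, Hk2.
      pose proof (exp_pos r). field; lra. }
  unfold Rminus; rewrite exp_plus.
  replace (exp (- (3 / 2) * r)) with (/ (exp (r / 2) * exp r)).
  2:{ rewrite <- exp_plus, <- exp_Ropp. f_equal; field. }
  replace (/ 2 * _) with (tau * sqrt PI * (sqrt 2 / (2 * k * k ^ 2)) * exp (- (tau ^ 2 / 4 * exp (- r)))) by (field; lra).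
  rewrite Hk2. unfold k. pose proof (exp_pos r). pose proof (exp_pos (r / 2)). field. lra.
- apply quad_decay_scal, quad_decay_affine; auto; lra.
- intros x. rewrite !Hf. replace (tau * - x) with (- (tau * x)) by ring. rewrite sin_neg.
  replace ((- x) ^ 2) with (x ^ 2) by ring. ring.
Qed.

(** The double exponential controls r + 2 v, not r. The slopes 3/2 - c + e/4 and 3/2 - c - e/4 yield
    decay at rate e/4 in |r + 2 v|; passing to |r| <= |r + 2 v| + 2 |v| costs e/2 in |v|, half of
    what [sin_exp_bound] supplies. *)
Lemma sin_Mellin_kernel_bound tau c v r : 0 < tau -> 0 < c < 1 / 2 ->
  let e := Rmin (2 * c) (1 - 2 * c) in
  Rabs (sin (tau * exp v)) * exp (2 * v + (3 / 2 - c) * r - exp (r + 2 * v)) <=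
  (1 + tau) * exp 2 * (exp (- (e / 2) * Rabs v) * exp (- (e / 4) * Rabs r)).
Proof.
intros Ht Hc e. pose proof (sin_exp_decay_pos c Hc) as He. fold e in He.
assert (He1 : e <= 1 / 2).
{ unfold e. unfold Rmin; destruct (Rle_dec (2 * c) (1 - 2 * c)); lra. }
apply Rle_trans with (Rabs (sin (tau * exp v)) * exp ((2 * c - 1) * v) *
   (exp 2 * exp (e / 2 * Rabs v - e / 4 * Rabs r))).
- rewrite Rmult_assoc. apply Rmult_le_compat_l; [apply Rabs_pos|].
  rewrite <- !exp_plus. apply exp_le.
  pose proof (sub_exp_le (3 / 2 - c + e / 4) (r + 2 * v) ltac:(lra)) as H1.
  pose proof (sub_exp_le (3 / 2 - c - e / 4) (r + 2 * v) ltac:(lra)) as H2.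
  assert ((3 / 2 - c + e / 4) ^ 2 / 2 <= 2) by nra.
  assert ((3 / 2 - c - e / 4) ^ 2 / 2 <= 2) by nra.
  assert (Rabs r <= Rabs (r + 2 * v) + 2 * Rabs v).
  { unfold Rabs; destruct (Rcase_abs r), (Rcase_abs (r + 2 * v)), (Rcase_abs v); lra. }
  assert (Hq : - exp (r + 2 * v) <= 2 - (3 / 2 - c) * (r + 2 * v) - e / 4 * Rabs (r + 2 * v)).
  { unfold Rabs; destruct (Rcase_abs (r + 2 * v)); lra. }
  assert (e / 4 * Rabs r <= e / 4 * (Rabs (r + 2 * v) + 2 * Rabs v)) by (apply Rmult_le_compat_l; lra).
  lra.
- pose proof (sin_exp_bound tau c v Ht Hc) as Hb. fold e in Hb.
  eapply Rle_trans.
  { apply Rmult_le_compat_r; [|exact Hb]. apply Rmult_le_pos; left; apply exp_pos. }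
  rewrite !Rmult_assoc. apply Rmult_le_compat_l; [lra|]. rewrite <- !exp_plus. apply exp_le. lra.
Qed.

(** One double integral in two orders. Over r first, the shift u = r + 2 v produces Gamma(3/2 - s)
    x^(2 s - 2) dx. Over v first, the Gaussian sine integral leaves exp (- c r - e^(l - r)) with a
    phase, and the reflection u = l - r produces Gamma(s). *)
Lemma sin_Mellin_GammaC tau c y : 0 < tau -> 0 < c < 1 / 2 ->
  let l := ln (tau ^ 2 / 4) in
  Cmult (GammaC (3 / 2 - c) (- y)) (sin_Mellin tau c y) =
  Cmult (RtoC (tau * sqrt PI / 4)) (Cmult (cexp (- c * l) (- y * l)) (GammaC c y)).
Proof.
intros Ht Hc l. assert (El : exp l = tau ^ 2 / 4) by (apply exp_ln; nra). assert (Hc' : 0 < 3 / 2 - c) by lra. assert (Hc0 : 0 < c) by lra.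
set (f := fun v r => Cmult (RtoC (sin (tau * exp v)))
   (cexp (2 * v + (3 / 2 - c) * r - exp (r + 2 * v)) (- y * r))).
set (e := Rmin (2 * c) (1 - 2 * c)).
assert (He : 0 < e) by now apply sin_exp_decay_pos.
destruct (prod_exp_bound (e / 2) (e / 4)) as [K [HK0 HK]]; [lra|lra|].
assert (Hfc : ccont2 f).
{ apply ccont2_mult; [apply ccont2_RtoC; solve_cont2|split; unfold cexp; cbn [fst snd]; solve_cont2]. }
assert (HfK : forall v r, Cmod (f v r) <= (1 + tau) * exp 2 * K / ((1 + v ^ 2) * (1 + r ^ 2))).
{ intros v r. unfold f. rewrite Cmod_mult, Cmod_cexp, Cmod_R.
  eapply Rle_trans; [now apply sin_Mellin_kernel_bound|]. fold e.
  replace ((1 + tau) * exp 2 * K / ((1 + v ^ 2) * (1 + r ^ 2))) with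
    ((1 + tau) * exp 2 * (K / ((1 + v ^ 2) * (1 + r ^ 2)))) by (unfold Rdiv; ring).
  apply Rmult_le_compat_l; [|apply HK]. apply Rmult_le_pos; [lra|left; apply exp_pos]. }
pose proof (CInt_Fubini f _ Hfc HfK) as HF.
assert (Hr : forall v, CInt (fun r => f v r) = Cmult (GammaC (3 / 2 - c) (- y))
   (Cmult (RtoC (sin (tau * exp v))) (cexp ((2 * c - 1) * v) (2 * y * v)))).
{ intros v. unfold f.
  pose proof (CInt_affine _ 1 (2 * v) ltac:(lra) (cquad_decay_GammaC (3 / 2 - c) (- y) Hc')) as H.
  rewrite Rabs_R1, Cmult_1_l in H. unfold GammaC. rewrite <- H.
  rewrite Cmult_comm, <- CInt_scal by (apply (cquad_decay_affine _ 1 (2 * v) ltac:(lra) (cquad_decay_GammaC (3 / 2 - c) (- y) Hc'))).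
  apply CInt_ext; intros r. rewrite <- Cmult_assoc, cexp_mult. do 2 f_equal.
  - replace (1 * r + 2 * v) with (r + 2 * v) by ring. field.
  - ring. }
assert (Hv : forall r, CInt (fun v => f v r) = Cmult (Cmult (RtoC (tau * sqrt PI / 4)) (cexp (- c * l) (- y * l)))
   (cexp (c * (-1 * r + l) - exp (-1 * r + l)) (y * (-1 * r + l)))).
{ intros r.
  rewrite (CInt_ext _ (fun v => Cmult (cexp ((3 / 2 - c) * r) (- y * r))
     (RtoC (sin (tau * exp v) * exp (2 * v - exp (r + 2 * v)))))).
  2:{ intros v. unfold f. rewrite RtoC_mult, RtoC_exp, Cmult_assoc, (Cmult_comm (cexp _ _) (RtoC _)), <- Cmult_assoc, cexp_mult.
      do 2 f_equal; ring. }
  rewrite CInt_scal, CInt_of_R, Int_sin_gauss_log.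
  - rewrite RtoC_mult, RtoC_exp, <- Cmult_assoc, cexp_mult.
    rewrite Cmult_assoc, (Cmult_comm (cexp _ _) (RtoC _)), <- Cmult_assoc, cexp_mult. do 2 f_equal.
    + rewrite (exp_plus (-1 * r) l). rewrite El.
      replace (-1 * r) with (- r) by ring. field.
    + ring.
  - apply cquad_decay_RtoC.
    (* Undoing the factor that depends on r alone makes this real integrand a slice of [f], so that
       the bound [HfK] applies. *)
    apply quad_decay_ext with (fun v => fst (Cmult (cexp (- (3 / 2 - c) * r) (y * r)) (f v r))).
    { intros v. unfold f. rewrite Cmult_assoc, (Cmult_comm (cexp _ _) (RtoC _)), <- Cmult_assoc, cexp_mult.
      replace (y * r + - y * r) with 0 by ring. rewrite <- RtoC_exp, <- RtoC_mult. simpl fst.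
      do 2 f_equal. ring. }
    apply (cquad_decay_re (fun v => Cmult (cexp (- (3 / 2 - c) * r) (y * r)) (f v r))), cquad_decay_scal. split.
    + destruct Hfc as [F1 F2]. split; [apply (cont2_l (fun v r => fst (f v r)) r F1)|apply (cont2_l (fun v r => snd (f v r)) r F2)].
    + exists ((1 + tau) * exp 2 * K); intros v. eapply Rle_trans; [apply HfK|].
      unfold Rdiv; apply Rmult_le_compat_l.
      * apply Rmult_le_pos; auto. apply Rmult_le_pos; [lra|left; apply exp_pos].
      * pose proof (one_plus_sq_pos v). apply Rinv_le_contravar; nra. }
rewrite (CInt_ext _ _ Hr) in HF. rewrite (CInt_ext _ _ Hv) in HF.
rewrite CInt_scal in HF by now apply cquad_decay_sin_Mellin.
change (CInt (fun v => Cmult (RtoC (sin (tau * exp v))) (cexp ((2 * c - 1) * v) (2 * y * v)))) with (sin_Mellin tau c y) in HF.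
rewrite HF.
rewrite CInt_scal by (apply (cquad_decay_affine _ (-1) l ltac:(lra) (cquad_decay_GammaC c y Hc0))).
rewrite <- Cmult_assoc. do 2 f_equal.
pose proof (CInt_affine _ (-1) l ltac:(lra) (cquad_decay_GammaC c y Hc0)) as H.
replace (Rabs (-1)) with 1 in H by (rewrite Rabs_left; lra). rewrite Cmult_1_l in H. exact H.
Qed.

(** * The Mellin-Barnes integral *)

(* The cosine transform int_0^oo exp(- x^alpha) cos(tau x) dx. *)
Definition cos_Mellin alpha tau := Int (fun v => exp (v - exp (alpha * v)) * cos (tau * exp v)).

Lemma stretched_log_bound alpha v : 0 < alpha ->
  exp (v - exp (alpha * v)) <= exp (2 / alpha ^ 2) * exp (- 1 * Rabs v).
Proof.
intros Ha. rewrite <- exp_plus; apply exp_le. pose proof (exp_pos (alpha * v)).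
assert (0 < 2 / alpha ^ 2) by (apply Rdiv_lt_0_compat; nra).
unfold Rabs; destruct (Rcase_abs v); [lra|].
pose proof (sub_exp_le (2 / alpha) (alpha * v)) as Hs.
assert (0 <= 2 / alpha) by (left; apply Rdiv_lt_0_compat; lra).
specialize (Hs H1). replace (2 / alpha * (alpha * v)) with (2 * v) in Hs by (field; lra).
replace ((2 / alpha) ^ 2 / 2) with (2 / alpha ^ 2) in Hs by (field; lra). lra.
Qed.

Lemma quad_decay_cos_Mellin alpha tau : 0 < alpha -> quad_decay (fun v => exp (v - exp (alpha * v)) * cos (tau * exp v)).
Proof.
intros Ha. apply quad_decay_bounded_mult with 1; [|solve_cont|intros; apply Rabs_cos_le].
apply quad_decay_exp_bound with (exp (2 / alpha ^ 2)) 1; [lra|solve_cont|].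
intros v. rewrite Rabs_right by (left; apply exp_pos). now apply stretched_log_bound.
Qed.

Lemma quad_decay_sin_stretched alpha tau : 0 < alpha ->
  quad_decay (fun v => exp (alpha * v - exp (alpha * v)) * sin (tau * exp v)).
Proof.
intros Ha. apply quad_decay_bounded_mult with 1; [|solve_cont|intros; apply Rabs_sin_le].
apply quad_decay_ext with (fun v => exp (1 * (alpha * v + 0) - exp (alpha * v + 0))).
- intros v; rewrite Rplus_0_r, Rmult_1_l; auto.
- apply (quad_decay_affine (fun v => exp (1 * v - exp v))); [lra|apply quad_decay_GammaR; lra].
Qed.

Lemma cos_Mellin_by_parts alpha tau : 0 < alpha -> 0 < tau ->
  tau * cos_Mellin alpha tau = alpha * Int (fun v => exp (alpha * v - exp (alpha * v)) * sin (tau * exp v)).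
Proof.
intros Ha Ht. unfold cos_Mellin.
rewrite <- !Int_scal by auto using quad_decay_cos_Mellin, quad_decay_sin_stretched.
apply Rminus_diag_uniq. rewrite <- Int_minus by auto using quad_decay_scal, quad_decay_cos_Mellin, quad_decay_sin_stretched.
apply Int_derive0 with (fun v => exp (- exp (alpha * v)) * sin (tau * exp v)).
- intros v. auto_derive; auto. unfold Rminus. rewrite !exp_plus. ring.
- solve_cont.
(* The boundary term decays at 0 thanks to |sin (tau x)| <= tau x, and at infinity thanks to exp (-
   x^alpha) <= e x^(- alpha). *)
- apply quad_decay_exp_bound with (tau + exp 1) (Rmin 1 alpha); [apply Rmin_pos; lra|solve_cont|].
  intros v. rewrite Rabs_mult, (Rabs_right (exp _)) by (left; apply exp_pos).
  pose proof (Rmin_l 1 alpha); pose proof (Rmin_r 1 alpha). pose proof (exp_pos v).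
  pose proof (exp_pos 1). pose proof (exp_pos (alpha * v)).
  destruct (Rle_dec v 0) as [Hv|Hv].
  + apply Rle_trans with (1 * (tau * exp v)).
    * apply Rmult_le_compat; [left; apply exp_pos|apply Rabs_pos| |].
      -- rewrite <- exp_0. apply exp_le; lra.
      -- eapply Rle_trans; [apply Rabs_sin_le_abs|]. rewrite Rabs_right; [lra|nra].
    * rewrite Rmult_1_l. apply Rmult_le_compat; try lra. apply exp_le.
      rewrite Rabs_left1 by lra. nra.
  + apply Rle_trans with (exp 1 * exp (- alpha * v) * 1).
    * apply Rmult_le_compat; [left; apply exp_pos|apply Rabs_pos| |apply Rabs_sin_le].
      rewrite <- exp_plus; apply exp_le. pose proof (sub_exp_le 1 (alpha * v) ltac:(lra)). lra.
    * rewrite Rmult_1_r. apply Rmult_le_compat; try lra; [left; apply exp_pos|].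
      apply exp_le. rewrite Rabs_right by lra. nra.
Qed.

Definition MB_integrand alpha c tau y : C :=
  Cmult (Cdiv (Cmult (GammaC c y) (GammaC ((1 - 2 * c) / alpha) (- (2 / alpha * y)))) (GammaC (1 / 2 - c) (- y)))
   (cexp (- c * ln (tau ^ 2 / 4)) (- y * ln (tau ^ 2 / 4))).

(** The functional equation gives Gamma((1 - 2 s) / alpha + 1) = (2 / alpha) (1/2 - s) Gamma((1 - 2
    s) / alpha) and Gamma(3/2 - s) = (1/2 - s) Gamma(1/2 - s). The factor 1/2 - s moves from the
    first onto the second, where [sin_Mellin_GammaC] evaluates the product; dividing by Gamma(1/2 -
    s) uses [GammaC_neq0]. *)
Lemma MB_integrand_eq alpha c tau y : 0 < alpha -> 0 < tau -> 0 < c < 1 / 2 ->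
  Cmult (GammaC ((1 - 2 * c) / alpha + 1) (- (2 / alpha) * y)) (sin_Mellin tau c y) =
  Cmult (RtoC (tau * sqrt PI / (2 * alpha))) (MB_integrand alpha c tau y).
Proof.
intros Ha Ht Hc. pose proof (sin_Mellin_GammaC tau c y Ht Hc) as HS. cbv zeta in HS.
replace (3 / 2 - c) with (1 / 2 - c + 1) in HS by field.
assert (Hb : 0 < (1 - 2 * c) / alpha) by (apply Rdiv_lt_0_compat; lra).
rewrite !GammaC_rec in * by lra. unfold MB_integrand.
pose proof (GammaC_neq0 (1 / 2 - c) (- y) ltac:(lra)) as Hn.
replace (- (2 / alpha) * y) with (- (2 / alpha * y)) by ring.
replace ((1 - 2 * c) / alpha, - (2 / alpha * y)) with (Cmult (RtoC (2 / alpha)) (1 / 2 - c, - y)).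
2:{ unfold Cmult, RtoC; simpl. f_equal; field; lra. }
set (p := (1 / 2 - c, - y) : C) in *.
set (g3 := GammaC (1 / 2 - c) (- y)) in *. set (g2 := GammaC ((1 - 2 * c) / alpha) _).
set (g1 := GammaC c y) in *. set (E := cexp _ _) in *. set (s := sin_Mellin tau c y) in *.
transitivity (Cdiv (Cmult (RtoC (2 / alpha)) (Cmult g2 (Cmult (Cmult p g3) s))) g3).
- field. exact Hn.
- rewrite HS. replace (tau * sqrt PI / (2 * alpha)) with (2 / alpha * (tau * sqrt PI / 4)) by (field; lra).
  rewrite (RtoC_mult (2 / alpha)). field. exact Hn.
Qed.

(** [Mellin_inversion] at the exponent b + 1, b = (1 - 2 c) / alpha, and at the point alpha v, after
    rescaling y by - 2 / alpha. The weight e^((2 c - 1) v) cancels the contribution b alpha v, so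
    the result is independent of c. *)
Lemma Mellin_inversion_stretched alpha c v : 0 < alpha -> 0 < c < 1 / 2 ->
  CInt (fun y => Cmult (GammaC ((1 - 2 * c) / alpha + 1) (- (2 / alpha) * y)) (cexp ((2 * c - 1) * v) (2 * y * v)))
  = RtoC (alpha * PI * exp (alpha * v - exp (alpha * v))).
Proof.
intros Ha Hc. set (b := (1 - 2 * c) / alpha).
assert (Hb : 0 < b) by (apply Rdiv_lt_0_compat; lra).
assert (Hk : 0 < 2 / alpha) by (apply Rdiv_lt_0_compat; lra).
assert (Hq : cquad_decay (fun y => Cmult (GammaC (b + 1) y) (cexp 0 (- (y * (alpha * v)))))).
{ split; [apply ccont_mult; [apply ccont_GammaC; lra|split; unfold cexp; cbn [fst snd]; solve_cont]|].
  destruct (GammaC_decay (b + 1) ltac:(lra)) as [K [_ HK]]. exists K; intros y.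
  rewrite Cmod_mult, Cmod_cexp, exp_0, Rmult_1_r. apply HK. }
pose proof (CInt_affine _ (- (2 / alpha)) 0 ltac:(lra) Hq) as H. cbv beta in H.
rewrite Mellin_inversion in H by lra. rewrite Rabs_left in H by lra.
rewrite (CInt_ext _ (fun y => Cmult (cexp ((2 * c - 1) * v) 0) (Cmult (GammaC (b + 1) (- (2 / alpha) * y + 0))
   (cexp 0 (- ((- (2 / alpha) * y + 0) * (alpha * v))))))).
2:{ intros y. rewrite Cmult_assoc, (Cmult_comm (cexp _ _) (GammaC _ _)), <- Cmult_assoc, cexp_mult.
    rewrite Rplus_0_r. do 2 f_equal; [ring|field; lra]. }
rewrite CInt_scal by (apply (cquad_decay_affine _ (- (2 / alpha)) 0 ltac:(lra) Hq)).
set (I := CInt _) in *.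
replace I with (Cmult (RtoC (alpha / 2)) (RtoC (2 * PI * exp ((b + 1) * (alpha * v) - exp (alpha * v))))).
- rewrite <- RtoC_mult, <- RtoC_exp, <- RtoC_mult. f_equal.
  replace (alpha * v - exp (alpha * v)) with ((2 * c - 1) * v + ((b + 1) * (alpha * v) - exp (alpha * v))).
  + rewrite (exp_plus ((2 * c - 1) * v)). field.
  + unfold b; field; lra.
- rewrite <- H, Cmult_assoc, <- RtoC_mult.
  replace (alpha / 2 * - - (2 / alpha)) with 1 by (field; lra). now rewrite Cmult_1_l.
Qed.

Lemma cquad_decay_GammaC_sin_Mellin alpha c tau : 0 < alpha -> 0 < tau -> 0 < c < 1 / 2 ->
  cquad_decay (fun y => Cmult (GammaC ((1 - 2 * c) / alpha + 1) (- (2 / alpha) * y)) (sin_Mellin tau c y)).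
Proof.
intros Ha Ht Hc. set (b := (1 - 2 * c) / alpha).
assert (Hb : 0 < b) by (apply Rdiv_lt_0_compat; lra).
assert (Hk : 0 < 2 / alpha) by (apply Rdiv_lt_0_compat; lra).
pose proof (cquad_decay_affine (fun y => GammaC (b + 1) y) (- (2 / alpha)) 0 ltac:(lra) (cquad_decay_GammaC_y (b + 1) ltac:(lra))) as Hq.
apply cquad_decay_ext with (fun y => Cmult (GammaC (b + 1) (- (2 / alpha) * y + 0)) (sin_Mellin tau c y)).
{ intros y; now rewrite Rplus_0_r. }
destruct (sin_Mellin_bound tau c Ht Hc) as [M [HM0 HM]]. destruct Hq as [Hq [K HK]].
split; [apply ccont_mult; auto using ccont_sin_Mellin|].
exists (K * M); intros y. rewrite Cmod_mult.
replace (K * M / (1 + y ^ 2)) with (K / (1 + y ^ 2) * M) by (unfold Rdiv; ring).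
apply Rmult_le_compat; auto using Cmod_ge_0.
Qed.

(** In modulus the double integrand is a function of y times a function of v, each with quadratic
    decay, so Fubini applies. Integrating over y first inverts the Mellin transform, and
    [cos_Mellin_by_parts] converts the resulting sine integral. *)
Lemma Mellin_Barnes_swap alpha c tau : 0 < alpha -> 0 < tau -> 0 < c < 1 / 2 ->
  CInt (fun y => Cmult (GammaC ((1 - 2 * c) / alpha + 1) (- (2 / alpha) * y)) (sin_Mellin tau c y)) =
  RtoC (PI * tau * cos_Mellin alpha tau).
Proof.
intros Ha Ht Hc. set (b := (1 - 2 * c) / alpha).
assert (Hb : 0 < b) by (apply Rdiv_lt_0_compat; lra).
assert (Hk : 0 < 2 / alpha) by (apply Rdiv_lt_0_compat; lra).
pose proof (cquad_decay_affine (fun y => GammaC (b + 1) y) (- (2 / alpha)) 0 ltac:(lra) (cquad_decay_GammaC_y (b + 1) ltac:(lra))) as Hq.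
assert (Hq' : cquad_decay (fun y => GammaC (b + 1) (- (2 / alpha) * y))).
{ eapply cquad_decay_ext; [|exact Hq]. intros y; simpl; now rewrite Rplus_0_r. }
destruct Hq' as [Hqc [K HK]]. clear Hq.
pose proof (sin_exp_decay_pos c Hc) as He.
set (M := (1 + tau) * (1 + 2 / Rmin (2 * c) (1 - 2 * c) ^ 2)).
assert (HM : forall v, Rabs (sin (tau * exp v)) * exp ((2 * c - 1) * v) <= M / (1 + v ^ 2)).
{ intros v. eapply Rle_trans; [now apply sin_exp_bound|]. unfold M, Rdiv at 1; rewrite Rmult_assoc.
  apply Rmult_le_compat_l; [lra|]. now apply exp_abs_bound. }
set (f := fun y v => Cmult (GammaC (b + 1) (- (2 / alpha) * y))
   (Cmult (RtoC (sin (tau * exp v))) (cexp ((2 * c - 1) * v) (2 * y * v)))).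
transitivity (CInt (fun y => CInt (fun v => f y v))).
{ apply CInt_ext; intros y. unfold f. rewrite CInt_scal; [reflexivity|now apply cquad_decay_sin_Mellin]. }
rewrite (CInt_Fubini f (K * M)).
- rewrite (CInt_ext _ (fun v => RtoC (alpha * PI * (exp (alpha * v - exp (alpha * v)) * sin (tau * exp v))))).
  + rewrite CInt_of_R, Int_scal by now apply quad_decay_sin_stretched. f_equal.
    replace (PI * tau * cos_Mellin alpha tau) with (PI * (tau * cos_Mellin alpha tau)) by ring.
    rewrite cos_Mellin_by_parts by auto. ring.
  + intros v. unfold f.
    rewrite (CInt_ext _ (fun y => Cmult (RtoC (sin (tau * exp v)))
      (Cmult (GammaC (b + 1) (- (2 / alpha) * y)) (cexp ((2 * c - 1) * v) (2 * y * v))))) by (intros; ring).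
    unfold b. rewrite CInt_scal.
    * rewrite Mellin_inversion_stretched by auto. rewrite <- RtoC_mult. f_equal; ring.
    * split; [apply ccont_mult; [exact Hqc|split; unfold cexp; cbn [fst snd]; solve_cont]|].
      exists (K * exp ((2 * c - 1) * v)); intros y. rewrite Cmod_mult, Cmod_cexp.
      replace (K * exp ((2 * c - 1) * v) / (1 + y ^ 2)) with (K / (1 + y ^ 2) * exp ((2 * c - 1) * v)) by (unfold Rdiv; ring).
      apply Rmult_le_compat_r; [left; apply exp_pos|apply HK].
- apply ccont2_mult; [exact (ccont2_of_l _ Hqc)|].
  apply ccont2_mult; [apply ccont2_RtoC; solve_cont2|split; unfold cexp; cbn [fst snd]; solve_cont2].
- intros y v. unfold f. rewrite !Cmod_mult, Cmod_cexp, Cmod_R.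
  pose proof (one_plus_sq_pos y); pose proof (one_plus_sq_pos v).
  replace (K * M / _) with (K / (1 + y ^ 2) * (M / (1 + v ^ 2))) by (field; lra).
  apply Rmult_le_compat; auto; [apply Cmod_ge_0|].
  apply Rmult_le_pos; [apply Rabs_pos|left; apply exp_pos].
Qed.

(** [MB_integrand_eq] read backwards: the integrand is a constant times a decaying Gamma factor and
    the bounded [sin_Mellin]. *)
Lemma cquad_decay_MB_integrand alpha c tau : 0 < alpha -> 0 < tau -> 0 < c < 1 / 2 ->
  cquad_decay (fun y => MB_integrand alpha c tau y).
Proof.
intros Ha Ht Hc. assert (Hp : 0 < sqrt PI) by apply sqrt_lt_R0, PI_RGT_0.
assert (0 < tau * sqrt PI) by nra.
apply cquad_decay_ext with (fun y => Cmult (RtoC (/ (tau * sqrt PI / (2 * alpha))))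
  (Cmult (GammaC ((1 - 2 * c) / alpha + 1) (- (2 / alpha) * y)) (sin_Mellin tau c y))).
- intros y. rewrite MB_integrand_eq, Cmult_assoc, <- RtoC_mult, Rinv_l by (auto; apply Rgt_not_eq, Rdiv_lt_0_compat; lra).
  apply Cmult_1_l.
- apply cquad_decay_scal, cquad_decay_GammaC_sin_Mellin; auto.
Qed.

Lemma MB_integrand_integral alpha c tau : 0 < alpha -> 0 < tau -> 0 < c < 1 / 2 ->
  Cmult (RtoC (sqrt PI)) (Cmult (RtoC (/ (2 * PI))) (CInt (fun y => MB_integrand alpha c tau y))) =
  RtoC (alpha * cos_Mellin alpha tau).
Proof.
intros Ha Ht Hc. pose proof PI_RGT_0. assert (Hp : 0 < sqrt PI) by now apply sqrt_lt_R0.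
pose proof (Mellin_Barnes_swap alpha c tau Ha Ht Hc) as H1.
rewrite (CInt_ext _ (fun y => Cmult (RtoC (tau * sqrt PI / (2 * alpha))) (MB_integrand alpha c tau y))) in H1
 by (intros; now apply MB_integrand_eq).
rewrite CInt_scal in H1 by now apply cquad_decay_MB_integrand.
set (I := CInt _) in *.
replace (RtoC (alpha * cos_Mellin alpha tau)) with (Cmult (RtoC (alpha / (PI * tau))) (RtoC (PI * tau * cos_Mellin alpha tau))).
2:{ rewrite <- RtoC_mult; f_equal; field; lra. }
rewrite <- H1, !Cmult_assoc, <- !RtoC_mult. f_equal. f_equal. field. lra.
Qed.

(** * Comparison with the definitions of the statement *)

(* Shadows the complex operations of Coquelicot by the convertible ones of the statement. *)
Require Import Defs.

Lemma Int_uniform f eps : quad_decay f -> 0 < eps -> exists N, 0 <= N /\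
  forall a b, a <= - N -> N <= b -> Rabs (RInt f a b - Int f) < eps.
Proof.
intros [Hf [K HK]] He. pose proof (quad_decay_K_nonneg f K HK) as HK0.
assert (He' : 0 < eps / (2 * K + 1)) by (apply Rdiv_lt_0_compat; lra).
destruct (proj2 (is_lim_seq_spec _ _) atan_lim (mkposreal _ He')) as [N HN].
specialize (HN N (Nat.le_refl _)); simpl in HN. exists (INR N); split; [apply pos_INR|].
intros a b Ha Hb. rewrite Rabs_minus_sym. eapply Rle_lt_trans; [apply (Int_err f K); auto|].
pose proof (atan_bound (INR N)). rewrite Rabs_left in HN by lra.
pose proof (atan_le _ _ Ha) as H1. rewrite atan_opp in H1. pose proof (atan_le _ _ Hb).
apply Rle_lt_trans with (K * (2 * (PI / 2 - atan (INR N)))).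
- apply Rmult_le_compat_l; lra.
- apply Rle_lt_trans with ((2 * K) * (eps / (2 * K + 1))).
  + rewrite <- Rmult_assoc, (Rmult_comm K 2). apply Rmult_le_compat_l; lra.
  + apply Rlt_le_trans with ((2 * K + 1) * (eps / (2 * K + 1))); [|right; field; lra].
    apply Rmult_lt_compat_r; lra.
Qed.

Lemma improper_int_R_Int f : quad_decay f -> improper_int_R f (Int f).
Proof.
intros Hf eps He. destruct (Int_uniform f eps Hf He) as [N [_ HN]]. exists N; intros a b Ha Hb.
exists (ex_RInt_Reals_0 f a b (ex_RInt_cont f a b (proj1 Hf))). rewrite <- RInt_Reals. auto.
Qed.

(** The substitution t = e^v on [a, b]; the cutoffs e^(- N) and e^N correspond to a window [- N, N]
    for g. *)
Lemma improper_int_pos_Int f g : quad_decay g -> (forall t, 0 < t -> f t = / t * g (ln t)) ->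
  improper_int_pos f (Int g).
Proof.
intros Hg Hfg eps He. destruct (Int_uniform g eps Hg He) as [N [HN0 HN]].
exists (exp (- N)), (exp N); split; [apply exp_pos|]. intros a b [Ha Ha'] Hb.
assert (Hab : a <= b).
{ pose proof (exp_le (- N) 0 ltac:(lra)). pose proof (exp_le 0 N ltac:(lra)). lra. }
assert (HI : is_RInt f a b (RInt g (ln a) (ln b))).
{ apply (is_RInt_ext (V := R_NormedModule) (fun t => scal (/ t) (g (ln t)))).
  - intros t Ht. rewrite Rmin_left, Rmax_right in Ht by auto. rewrite Hfg by lra. reflexivity.
  - apply (is_RInt_comp (V := R_CompleteNormedModule) g ln Rinv); intros t Ht;
      rewrite Rmin_left, Rmax_right in Ht by auto.
    + apply continuity_pt_filterlim, (proj1 Hg).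
    + split; [apply is_derive_Reals, derivable_pt_lim_ln; lra|].
      apply continuity_pt_filterlim, continuity_pt_inv; [reg|lra]. }
assert (HE : ex_RInt f a b) by (eexists; exact HI).
exists (ex_RInt_Reals_0 f a b HE). rewrite <- RInt_Reals.
rewrite (is_RInt_unique _ _ _ _ HI). apply HN.
- rewrite <- (ln_exp (- N)). apply ln_le; lra.
- rewrite <- (ln_exp N). apply ln_le; [apply exp_pos|lra].
Qed.

Lemma improper_int_pos_unique f l l' : improper_int_pos f l -> improper_int_pos f l' -> l = l'.
Proof.
intros H H'. apply cond_eq; intros eps He.
destruct (H (eps / 2) ltac:(lra)) as [d [M [Hd HM]]].
destruct (H' (eps / 2) ltac:(lra)) as [d' [M' [Hd' HM']]].
pose proof (Rmin_l d d'); pose proof (Rmin_r d d'). pose proof (Rmin_pos d d' Hd Hd').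
pose proof (Rmax_l M M'); pose proof (Rmax_r M M').
destruct (HM (Rmin d d') (Rmax M M') ltac:(lra) ltac:(lra)) as [pr Hp].
destruct (HM' (Rmin d d') (Rmax M M') ltac:(lra) ltac:(lra)) as [pr' Hp'].
rewrite <- RInt_Reals in Hp, Hp'. apply Rabs_def2 in Hp, Hp'. apply Rabs_def1; lra.
Qed.

(** [Gamma] and [CGamma] are values picked by [epsilon]; existence and uniqueness of the improper
    integral identify them. *)
Lemma epsilon_improper_int_pos f g : quad_decay g -> (forall t, 0 < t -> f t = / t * g (ln t)) ->
  epsilon (inhabits 0) (fun l => improper_int_pos f l) = Int g.
Proof.
intros Hg Hfg. pose proof (improper_int_pos_Int f g Hg Hfg) as H.
apply (improper_int_pos_unique f); [|exact H].
apply (epsilon_spec (inhabits 0) (fun l => improper_int_pos f l)). eexists; exact H.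
Qed.

Lemma Gamma_log_integrand t a : 0 < t -> Rpower t (a - 1) * exp (- t) = / t * exp (a * ln t - exp (ln t)).
Proof.
intros Ht. unfold Rpower, Rminus. rewrite exp_ln, exp_plus by auto.
replace ((a + - (1)) * ln t) with (- ln t + a * ln t) by ring.
rewrite exp_plus, exp_Ropp, exp_ln by auto. ring.
Qed.

Lemma Gamma_GammaR a : 0 < a -> Gamma a = GammaR a.
Proof.
intros Ha. apply epsilon_improper_int_pos; [now apply quad_decay_GammaR|].
intros t Ht; now apply Gamma_log_integrand.
Qed.

Lemma Gamma_pos a : 0 < a -> 0 < Gamma a.
Proof. intros Ha. rewrite Gamma_GammaR by auto. now apply GammaR_pos. Qed.

Lemma CGamma_GammaC a y : 0 < a -> CGamma (a, y) = GammaC a y.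
Proof.
intros Ha. pose proof (cquad_decay_GammaC a y Ha) as Hq. unfold CGamma, GammaC, CInt. cbn [fst snd]. f_equal.
- apply epsilon_improper_int_pos; [exact (cquad_decay_re _ Hq)|].
  intros t Ht. rewrite Gamma_log_integrand by auto. cbn [cexp fst]. ring.
- apply epsilon_improper_int_pos; [exact (cquad_decay_im _ Hq)|].
  intros t Ht. rewrite Gamma_log_integrand by auto. cbn [cexp snd]. ring.
Qed.

(** * The generalized Gaussian density and its characteristic function *)

Definition stretched (alpha u : R) := exp (- rpow (Rabs u) alpha).

Lemma rpow_continuous alpha : 0 < alpha -> continuity (fun u => rpow (Rabs u) alpha).
Proof.
intros Ha u. destruct (Req_dec u 0) as [-> |Hu].
(* At 0 the modulus of continuity is eps^(1 / alpha); elsewhere the function is locally exp (alpha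
   ln |u|). *)
- intros eps He. exists (Rpower eps (/ alpha)). split; [apply exp_pos|].
  intros x [_ Hx]. simpl in *. unfold R_dist in *. rewrite Rminus_0_r in Hx.
  rewrite Rabs_R0. unfold rpow. destruct (Rlt_dec 0 0) as [H|_]; [lra|]. rewrite Rminus_0_r.
  destruct (Rlt_dec 0 (Rabs x)) as [H|_]; [|now rewrite Rabs_R0].
  rewrite Rabs_right by (left; apply exp_pos).
  replace eps with (Rpower (Rpower eps (/ alpha)) alpha).
  + apply Rlt_Rpower_l; auto; lra.
  + rewrite Rpower_mult, Rinv_l, Rpower_1 by lra; reflexivity.
- assert (Hp : 0 < Rabs u) by now apply Rabs_pos_lt.
  apply continuity_pt_filterlim.
  apply (continuous_ext_loc (T := R_UniformSpace) (U := R_UniformSpace) (fun u => rpow (Rabs u) alpha) (fun x => exp (alpha * ln (Rabs x)))).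
  + exists (mkposreal _ Hp). intros x Hx. change (Rabs (x - u) < Rabs u) in Hx.
    unfold rpow. destruct (Rlt_dec 0 (Rabs x)) as [_|H]; [reflexivity|].
    exfalso. apply H, Rabs_pos_lt. intros ->. rewrite Rminus_0_l, Rabs_Ropp in Hx. lra.
  + apply continuity_pt_filterlim.
    apply (continuity_pt_comp (fun x => alpha * ln (Rabs x)) exp); [|apply continuity_exp].
    apply (continuity_pt_mult (fun _ => alpha)); [apply continuity_pt_const; intros ? ?; auto|].
    apply (continuity_pt_comp Rabs ln); [apply Rcontinuity_abs|].
    apply derivable_continuous_pt. exists (/ Rabs u). now apply derivable_pt_lim_ln.
Qed.

Lemma stretched_exp alpha v : stretched alpha (exp v) = exp (- exp (alpha * v)).
Proof.
unfold stretched, rpow. rewrite Rabs_right by (left; apply exp_pos).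
destruct (Rlt_dec 0 (exp v)) as [_|H]; [|destruct (H (exp_pos v))].
unfold Rpower. now rewrite ln_exp.
Qed.

Lemma stretched_even alpha u : stretched alpha (- u) = stretched alpha u.
Proof. unfold stretched; now rewrite Rabs_Ropp. Qed.

Lemma quad_decay_stretched alpha : 0 < alpha -> quad_decay (stretched alpha).
Proof.
intros Ha. split.
- apply (continuity_comp (fun u => - rpow (Rabs u) alpha) exp); [|apply continuity_exp].
  apply (continuity_opp (fun u => rpow (Rabs u) alpha)). now apply rpow_continuous.
- set (K := exp ((2 / alpha) ^ 2 / 2)). exists (1 + K). intros u.
  assert (Hpos : 0 < stretched alpha u) by apply exp_pos.
  rewrite Rabs_right by lra. pose proof (one_plus_sq_pos u).
  apply Rmult_le_reg_r with (1 + u ^ 2); auto.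
  replace ((1 + K) / (1 + u ^ 2) * (1 + u ^ 2)) with (1 + K) by (field; lra).
  assert (H1 : stretched alpha u <= 1).
  { unfold stretched. rewrite <- exp_0. apply exp_le. unfold rpow.
    destruct (Rlt_dec 0 (Rabs u)); [|lra]. pose proof (exp_pos (alpha * ln (Rabs u))).
    unfold Rpower; lra. }
  assert (HK : 0 < K) by apply exp_pos.
  destruct (Req_dec u 0) as [-> |Hu]; [lra|].
  assert (Hp : 0 < Rabs u) by now apply Rabs_pos_lt.
  (* With |u| = e^v this is 2 v - e^(alpha v) <= (2 / alpha)^2 / 2, that is [sub_exp_le] with p = 2
     / alpha at alpha v. *)
  assert (H2 : stretched alpha u * u ^ 2 <= K).
  { replace (stretched alpha u) with (stretched alpha (Rabs u)) by (unfold stretched; now rewrite Rabs_Rabsolu).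
    rewrite <- (pow2_abs u), <- (exp_ln (Rabs u)) by auto. set (v := ln (Rabs u)).
    rewrite stretched_exp. simpl pow. rewrite Rmult_1_r, <- !exp_plus. apply exp_le.
    assert (0 < 2 / alpha) by (apply Rdiv_lt_0_compat; lra).
    pose proof (sub_exp_le (2 / alpha) (alpha * v) ltac:(lra)) as Hs.
    replace (2 / alpha * (alpha * v)) with (2 * v) in Hs by (field; lra). lra. }
  lra.
Qed.

Lemma Int_stretched_cos alpha tau : 0 < alpha ->
  Int (fun u => stretched alpha u * cos (tau * u)) = 2 * cos_Mellin alpha (Rabs tau).
Proof.
intros Ha.
rewrite (Int_ext _ (fun u => stretched alpha u * cos (Rabs tau * u))).
2:{ intros u. unfold Rabs at 1; destruct (Rcase_abs tau); auto.
    replace (- tau * u) with (- (tau * u)) by ring. now rewrite cos_neg. }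
set (f := fun u => stretched alpha u * cos (Rabs tau * u)).
assert (Hf : quad_decay f) by (apply quad_decay_bounded_mult with 1; [now apply quad_decay_stretched|solve_cont|intros; apply Rabs_cos_le]).
replace (Int f) with (2 * (/ 2 * Int f)) by field. rewrite <- Int_even_log; auto.
- f_equal. apply Int_ext; intros v. unfold f. rewrite stretched_exp, <- Rmult_assoc, <- exp_plus.
  reflexivity.
- intros x; unfold f. rewrite stretched_even. replace (Rabs tau * - x) with (- (Rabs tau * x)) by ring.
  now rewrite cos_neg.
Qed.

Lemma Int_stretched_sin alpha tau : 0 < alpha ->
  Int (fun u => stretched alpha u * sin (tau * u)) = 0.
Proof.
intros Ha. apply Int_odd.
- apply quad_decay_bounded_mult with 1; [now apply quad_decay_stretched|solve_cont|intros; apply Rabs_sin_le].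
- intros x; cbv beta. rewrite stretched_even. replace (tau * - x) with (- (tau * x)) by ring.
  rewrite sin_neg; ring.
Qed.

Lemma GGD_Lambda_pos sigma alpha : 0 < sigma -> 0 < alpha -> 0 < GGD_Lambda sigma alpha.
Proof.
intros Hs Ha. unfold GGD_Lambda. apply Rmult_lt_0_compat; [now apply Rinv_0_lt_compat|].
apply sqrt_lt_R0, Rdiv_lt_0_compat; apply Gamma_pos, Rdiv_lt_0_compat; lra.
Qed.

Lemma GGD_density_eq mu sigma alpha x : 0 < sigma -> 0 < alpha ->
  let L := GGD_Lambda sigma alpha in
  GGD_density mu sigma alpha x = alpha * L / (2 * Gamma (1 / alpha)) * stretched alpha (L * x + - (L * mu)).
Proof.
intros Hs Ha L. unfold GGD_density. fold L. f_equal. unfold stretched. f_equal. f_equal.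
assert (HL : 0 < L) by now apply GGD_Lambda_pos.
replace (L * x + - (L * mu)) with (L * (x - mu)) by ring.
rewrite Rabs_mult, (Rabs_right L) by lra. unfold rpow.
destruct (Rlt_dec 0 L) as [_|]; [|lra].
(* The case x = mu is separate: there [rpow] takes its value 0 on both sides. *)
destruct (Rlt_dec 0 (Rabs (x - mu))) as [H|H], (Rlt_dec 0 (L * Rabs (x - mu))) as [H'|H'].
- apply Rpower_mult_distr; auto.
- destruct H'; now apply Rmult_lt_0_compat.
- exfalso. assert (Rabs (x - mu) = 0) as E by (pose proof (Rabs_pos (x - mu)); lra).
  rewrite E, Rmult_0_r in H'; lra.
- ring.
Qed.

Lemma GGD_charfun_cos_Mellin mu sigma alpha t : 0 < sigma -> 0 < alpha ->
  let A := alpha * cos_Mellin alpha (Rabs (t / GGD_Lambda sigma alpha)) / Gamma (1 / alpha) in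
  GGD_charfun_is mu sigma alpha t (A * cos (t * mu), A * sin (t * mu)).
Proof.
intros Hs Ha. set (L := GGD_Lambda sigma alpha).
assert (HL : 0 < L) by now apply GGD_Lambda_pos.
assert (HG : 0 < Gamma (1 / alpha)) by (apply Gamma_pos, Rdiv_lt_0_compat; lra).
set (K0 := alpha * L / (2 * Gamma (1 / alpha))).
assert (Qc : quad_decay (fun u => stretched alpha u * cos (t / L * u)))
 by (apply quad_decay_bounded_mult with 1; [now apply quad_decay_stretched|solve_cont|intros; apply Rabs_cos_le]).
assert (Qs : quad_decay (fun u => stretched alpha u * sin (t / L * u)))
 by (apply quad_decay_bounded_mult with 1; [now apply quad_decay_stretched|solve_cont|intros; apply Rabs_sin_le]).
(* With u = L (x - mu), the addition formulas for t x = t mu + (t / L) u write both the real and the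
   imaginary part in this form; the sine term integrates to 0 by oddness. *)
assert (Hlin : forall p q, let f := fun u => p * (stretched alpha u * cos (t / L * u)) +
    q * (stretched alpha u * sin (t / L * u)) in
  quad_decay (fun x => f (L * x + - (L * mu))) /\
  Int (fun x => f (L * x + - (L * mu))) = p * (2 * cos_Mellin alpha (Rabs (t / L))) / L).
{ intros p q f. assert (Hq : quad_decay f) by (apply quad_decay_plus; now apply quad_decay_scal).
  split; [apply quad_decay_affine; auto; lra|].
  apply Rmult_eq_reg_l with L; [|lra]. rewrite Int_affine_pos by auto.
  unfold f. rewrite Int_plus, !Int_scal, Int_stretched_cos, Int_stretched_sin by auto using quad_decay_scal.
  field; lra. }
intros A; split; cbn [fst snd].
- destruct (Hlin (K0 * cos (t * mu)) (- (K0 * sin (t * mu)))) as [Hq HI]; cbv beta in Hq, HI.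
  match type of HI with Int ?g = _ => set (f := g) in * end.
  assert (E : forall x, f x = fst (Cmul (RtoC (GGD_density mu sigma alpha x)) (Cexpi (t * x)))).
  { intros x. unfold f. cbn [fst snd Cmul RtoC Cexpi]. rewrite GGD_density_eq by auto. fold L; fold K0.
    replace (t * x) with (t * mu + t / L * (L * x + - (L * mu))) by (field; lra).
    rewrite cos_plus. ring. }
  replace (A * cos (t * mu)) with (Int f).
  + rewrite (Int_ext _ _ E). apply improper_int_R_Int. exact (quad_decay_ext _ _ E Hq).
  + rewrite HI. unfold A, K0. fold L. field; lra.
- destruct (Hlin (K0 * sin (t * mu)) (K0 * cos (t * mu))) as [Hq HI]; cbv beta in Hq, HI.
  match type of HI with Int ?g = _ => set (f := g) in * end.
  assert (E : forall x, f x = snd (Cmul (RtoC (GGD_density mu sigma alpha x)) (Cexpi (t * x)))).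
  { intros x. unfold f. cbn [fst snd Cmul RtoC Cexpi]. rewrite GGD_density_eq by auto. fold L; fold K0.
    replace (t * x) with (t * mu + t / L * (L * x + - (L * mu))) by (field; lra).
    rewrite sin_plus. ring. }
  replace (A * sin (t * mu)) with (Int f).
  + rewrite (Int_ext _ _ E). apply improper_int_R_Int. exact (quad_decay_ext _ _ E Hq).
  + rewrite HI. unfold A, K0. fold L. field; lra.
Qed.

(** The real parts c, (1 - 2 c) / alpha and 1/2 - c of the three Gamma arguments are positive in the
    strip, which is where [CGamma] agrees with [GammaC]. *)
Lemma FoxH_integrand_eq alpha tau c y : 0 < alpha -> 0 < tau -> 0 < c < 1 / 2 ->
  FoxH_11_12_integrand (1 - 1 / alpha) (2 / alpha) 0 1 (1 / 2) 1 (tau ^ 2 / 4) c y = MB_integrand alpha c tau y.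
Proof.
intros Ha Ht Hc. unfold FoxH_11_12_integrand. cbn [fst snd].
replace (0 + 1 * c) with c by ring. replace (1 * y) with y by ring.
replace (1 - (1 - 1 / alpha) - 2 / alpha * c) with ((1 - 2 * c) / alpha) by (field; lra).
replace (1 - 1 / 2 - 1 * c) with (1 / 2 - c) by field.
rewrite !CGamma_GammaC by (try apply Rdiv_lt_0_compat; lra).
unfold MB_integrand. change Cmul with Cmult. f_equal.
unfold Rpower, cexp, Cmult, RtoC, Cexpi. cbn [fst snd].
replace (- y * ln (tau ^ 2 / 4)) with (- (y * ln (tau ^ 2 / 4))) by ring. f_equal; ring.
Qed.

Theorem theorem1 (alpha mu sigma t c : R) :
  0 < alpha -> 0 < sigma -> t <> 0 ->
  (* L = c + iR with 0 < c < 1/2 separates the poles 0,-1,-2,... of Gamma(s)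
     from the poles (1+k alpha)/2, k >= 0, of Gamma(1/alpha - 2s/alpha) *)
  0 < c < 1 / 2 ->
  exists h : Cplx,
    FoxH_11_12_along (1 - 1 / alpha) (2 / alpha) 0 1 (1 / 2) 1
      (sigma ^ 2 * Gamma (1 / alpha) / (4 * Gamma (3 / alpha)) * t ^ 2) c h /\
    GGD_charfun_is mu sigma alpha t
      (Cmul (RtoC (sqrt PI / Gamma (1 / alpha))) (Cmul (Cexpi (t * mu)) h)).
Proof.
intros Ha Hs Ht Hc.
assert (HL : 0 < GGD_Lambda sigma alpha) by now apply GGD_Lambda_pos.
(* The frequency after standardizing X by u = L (x - mu); tau^2 / 4 is the argument of the
   H-function, and tau > 0 because t is nonzero. *)
set (tau := Rabs (t / GGD_Lambda sigma alpha)).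
assert (HG1 : 0 < Gamma (1 / alpha)) by (apply Gamma_pos, Rdiv_lt_0_compat; lra).
assert (HG3 : 0 < Gamma (3 / alpha)) by (apply Gamma_pos, Rdiv_lt_0_compat; lra).
assert (Htau : 0 < tau).
{ apply Rabs_pos_lt. unfold Rdiv. apply Rmult_integral_contrapositive_currified; auto.
  apply Rinv_neq_0_compat; lra. }
assert (Hz : sigma ^ 2 * Gamma (1 / alpha) / (4 * Gamma (3 / alpha)) * t ^ 2 = tau ^ 2 / 4).
{ unfold tau. rewrite pow2_abs.
  replace ((t / GGD_Lambda sigma alpha) ^ 2) with (t ^ 2 / GGD_Lambda sigma alpha ^ 2) by (field; lra).
  unfold GGD_Lambda. rewrite Rpow_mult_distr, pow2_sqrt by (left; now apply Rdiv_lt_0_compat).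
  field. lra. }
rewrite Hz.
pose proof (cquad_decay_scal (RtoC (/ (2 * PI))) _ (cquad_decay_MB_integrand alpha c tau Ha Htau Hc)) as Hq.
set (h := CInt (fun y => Cmult (RtoC (/ (2 * PI))) (MB_integrand alpha c tau y))).
assert (E : forall y, Cmult (RtoC (/ (2 * PI))) (MB_integrand alpha c tau y) = Cmul (RtoC (/ (2 * PI)))
  (FoxH_11_12_integrand (1 - 1 / alpha) (2 / alpha) 0 1 (1 / 2) 1 (tau ^ 2 / 4) c y))
 by (intros y; now rewrite FoxH_integrand_eq).
exists h; split.
- unfold h. rewrite (CInt_ext _ _ E). apply (cquad_decay_ext _ _ E) in Hq.
  split; apply improper_int_R_Int; [exact (cquad_decay_re _ Hq)|exact (cquad_decay_im _ Hq)].
- pose proof (MB_integrand_integral alpha c tau Ha Htau Hc) as HI.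
  rewrite <- CInt_scal in HI by now apply cquad_decay_MB_integrand.
  change (Cmult (RtoC (sqrt PI)) h = RtoC (alpha * cos_Mellin alpha tau)) in HI.
  pose proof (GGD_charfun_cos_Mellin mu sigma alpha t Hs Ha) as HC. cbv zeta in HC. fold tau in HC.
  match type of HC with GGD_charfun_is _ _ _ _ ?p => replace (Cmul _ _) with p; [exact HC|] end.
  replace (RtoC (sqrt PI / Gamma (1 / alpha))) with (Cmult (RtoC (/ Gamma (1 / alpha))) (RtoC (sqrt PI)))
   by (unfold Cmult, RtoC; cbn [fst snd]; f_equal; field; lra).
  (* Regrouped so that sqrt(PI) h appears as one factor, which [HI] shows to be the real number
     alpha times [cos_Mellin alpha tau]. *)
  transitivity (Cmult (Cmult (RtoC (/ Gamma (1 / alpha))) (Cexpi (t * mu))) (Cmult (RtoC (sqrt PI)) h)).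
  + rewrite HI. unfold Cmult, RtoC, Cexpi; cbn [fst snd]. f_equal; field; lra.
  + assert (Hsh : forall a b d e : C, Cmult (Cmult a b) (Cmult d e) = Cmult (Cmult a d) (Cmult b e))
      by (intros; ring).
    exact (Hsh _ _ _ _).
Qed.
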